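(* Let $(R,\mathfrak{m})$ be a commutative noetherian local ring, and let $M$ be a separated $R$-module such that its $\mathfrak{m}$-adic completion $\hat M$ is flat as an $R$-module. Then the following are equivalent: (i) $M$ is totally separated. (ii) For every prime ideal $\mathfrak{p}$ of $R$, $M/\mathfrak{p}M$ is separated. (iii) $M$ is pure in $\hat M$. If $R$ is complete, these are moreover equivalent to: (iv) $M$ is a Mittag-Leffler module.
   Context: An $R$-module $A$ is separated if $\bigcap_{n\ge1}\mathfrak{m}^nA=0$; a separated module $M$ is regarded as a submodule of $\hat M=\varprojlim M/\mathfrak{m}^nM$ via the canonical map. $M$ is totally separated if $X\otimes_RM$ is separated for every finitely generated $R$-module $X$. $M$ is a Mittag-Leffler module if for every family $(Q_i\mid i\in I)$ of $R$-modules the canonical map $M\otimes_R\prod_iQ_i\to\prod_i(M\otimes_RQ_i)$ is injective. *)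

(* Defs.v *)
From HB Require Import structures.
From mathcomp Require Import all_boot all_order all_algebra.
From mathcomp Require Import finmap boolp.
From mathcomp Require Import monalg.

Set Implicit Arguments.
Unset Strict Implicit.
Unset Printing Implicit Defensive.

Import GRing.Theory.
Local Open Scope ring_scope.
Local Open Scope quotient_scope.

(* Subsets are boolean predicates, as in [GRing.submodClosed] and
   [Quotient.quot]; membership in a set given by a Prop is reflected
   classically.  An ideal of R is a submodule of the regular module R^o. *)

Section Span.
Variables (R : comNzRingType) (V : lmodType R).

Definition lspan (S : V -> Prop) : {pred V} :=
  [pred x | `[< exists s : seq (R * V),
    (forall p, p \in s -> S p.2) /\ x = \sum_(p <- s) p.1 *: p.2 >]].

Lemma lspanP (S : V -> Prop) x :
  reflect (exists s : seq (R * V),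
    (forall p, p \in s -> S p.2) /\ x = \sum_(p <- s) p.1 *: p.2)
  (x \in lspan S).
Proof. exact: asboolP. Qed.

Lemma lspan_submod_closed S : submod_closed (lspan S).
Proof.
split=> [|a x y].
  by apply/lspanP; exists [::]; split=> //; rewrite big_nil.
move=> /lspanP[s [sS ->]] /lspanP[t [tS ->]]; apply/lspanP.
exists ([seq (a * p.1, p.2) | p <- s] ++ t); split=> [p|].
  by rewrite mem_cat => /orP[/mapP[q /sS ? ->]|/tS].
rewrite big_cat big_map scaler_sumr /=; congr (_ + _).
by apply: eq_bigr => p _; rewrite scalerA.
Qed.
HB.instance Definition _ S :=
  GRing.isSubmodClosed.Build R V (lspan S) (lspan_submod_closed S).

Lemma mem_lspan (S : V -> Prop) x : S x -> x \in lspan S.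
Proof.
move=> Sx; apply/lspanP; exists [:: (1, x)]; split.
  by move=> p; rewrite inE => /eqP ->.
by rewrite big_seq1 scale1r.
Qed.

Lemma lspan_min (S : V -> Prop) (U : submodClosed V) :
  (forall x, S x -> x \in U) -> {subset lspan S <= U}.
Proof.
move=> SU x /lspanP[s [sS ->]].
by rewrite big_seq; apply: rpred_sum => p /sS /SU Up; apply: rpredZ.
Qed.

Definition finitely_generated : Prop :=
  exists s : seq V, forall x, x \in lspan (fun y => y \in s).

(* The submodule IU generated by the products a *: x, a in I, x in U. *)
Definition smul (I : {pred R}) (U : {pred V}) : {pred V} :=
  lspan (fun z => exists2 a, a \in I & exists2 x, x \in U & z = a *: x).
HB.instance Definition _ I U := GRing.SubmodClosed.on (smul I U).

End Span.
Arguments finitely_generated {R} V.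

Section Ideals.
Variable R : comNzRingType.

Definition noetherian : Prop :=
  forall I : {pred R^o}, submod_closed I ->
    exists s : seq R^o, I =i lspan (fun y => y \in s).

(* [idealr_closed] is the library's notion of proper ideal. *)
Definition maximal_ideal (m : {pred R}) : Prop :=
  idealr_closed m /\
  forall J : {pred R}, idealr_closed J -> {subset m <= J} -> {subset J <= m}.

Definition local_ring (m : {pred R}) : Prop :=
  maximal_ideal m /\ forall J : {pred R}, maximal_ideal J -> J =i m.

Definition idpow (I : {pred R}) (n : nat) : {pred R} :=
  iter n (@smul R R^o I) predT.

End Ideals.

Section QuotientModule.
Variables (R : comNzRingType) (V : lmodType R) (U : submodClosed V).

(* Over a ring a submodule is closed under opposite, but the library's
   hierarchy does not derive [zmodClosed] from [submodClosed]. *)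
Fact submod_oppr_closed : oppr_closed U.
Proof. by move=> x Ux; rewrite -scaleN1r rpredZ. Qed.
Definition submod_zmod : zmodClosed V :=
  HB.pack_for (zmodClosed V) (GRing.SubmodClosed.sort U)
    (GRing.isOppClosed.Build V U submod_oppr_closed).

Definition lquot : Type := Quotient.quot submod_zmod.

HB.instance Definition _ := Choice.on lquot.
HB.instance Definition _ := EqQuotient.on lquot.
HB.instance Definition _ := GRing.Zmodule.on lquot.

Definition lpi (x : V) : lquot := \pi_(Quotient.quot submod_zmod) x.

Lemma lpi_eq x y : (lpi x == lpi y) = (x - y \in U).
Proof. exact/esym/(Quotient.idealrBE submod_zmod x y). Qed.

Lemma lpi_eqP x y : reflect (lpi x = lpi y) (x - y \in U).
Proof. by rewrite -lpi_eq; apply: eqP. Qed.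

Definition lrep (q : lquot) : V := repr (q : Quotient.quot submod_zmod).

Lemma lrepK : cancel lrep lpi.
Proof. by move=> q; apply: reprK. Qed.

Lemma lpi_rep x : lrep (lpi x) - x \in U.
Proof. by apply/lpi_eqP; rewrite lrepK. Qed.

Lemma lpiB : {morph lpi : x y / x - y}.
Proof. by move=> x y; rewrite /lpi raddfB. Qed.

Lemma lpiD : {morph lpi : x y / x + y}.
Proof. by move=> x y; rewrite /lpi raddfD. Qed.

Definition lscale (a : R) (q : lquot) : lquot := lpi (a *: lrep q).

Lemma lpiZ a x : lpi (a *: x) = lscale a (lpi x).
Proof.
by apply/lpi_eqP; rewrite -scalerBr rpredZ // -opprB submod_oppr_closed // lpi_rep.
Qed.

Fact lscaleA a b q : lscale a (lscale b q) = lscale (a * b) q.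
Proof. by rewrite -[q]lrepK -!lpiZ scalerA. Qed.
Fact lscale1 : left_id 1 lscale.
Proof. by move=> q; rewrite -[q]lrepK -lpiZ scale1r. Qed.
Fact lscaleDr : right_distributive lscale +%R.
Proof.
by move=> a p q; rewrite -[p]lrepK -[q]lrepK -lpiD -!lpiZ -lpiD scalerDr.
Qed.
Fact lscaleDl q : {morph lscale^~ q : a b / a + b}.
Proof. by move=> a b; rewrite -[q]lrepK -!lpiZ -lpiD scalerDl. Qed.

HB.instance Definition _ :=
  GRing.Zmodule_isLmodule.Build R lquot lscaleA lscale1 lscaleDr lscaleDl.

Fact lpi_linear : linear lpi.
Proof. by move=> a x y; rewrite lpiD lpiZ. Qed.
HB.instance Definition _ := GRing.isLinear.Build R V lquot _ lpi lpi_linear.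

End QuotientModule.

Section ProductModule.
Variables (R : comNzRingType) (I : Type) (Q : I -> lmodType R).

Definition dprod : Type := forall i, Q i.

HB.instance Definition _ := gen_eqMixin dprod.
HB.instance Definition _ := gen_choiceMixin dprod.

Implicit Types x y : dprod.
Let dzero : dprod := fun i => 0.
Let dopp x : dprod := fun i => - x i.
Let dadd x y : dprod := fun i => x i + y i.
Let dscale (a : R) x : dprod := fun i => a *: x i.

Fact daddA : associative dadd.
Proof. by move=> x y z; apply: functional_extensionality_dep => i; apply: addrA. Qed.
Fact daddC : commutative dadd.
Proof. by move=> x y; apply: functional_extensionality_dep => i; apply: addrC. Qed.
Fact dadd0 : left_id dzero dadd.
Proof. by move=> x; apply: functional_extensionality_dep => i; apply: add0r. Qed.
Fact daddN : left_inverse dzero dopp dadd.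
Proof. by move=> x; apply: functional_extensionality_dep => i; apply: addNr. Qed.
HB.instance Definition _ := GRing.isZmodule.Build dprod daddA daddC dadd0 daddN.

Fact dscaleA a b x : dscale a (dscale b x) = dscale (a * b) x.
Proof. by apply: functional_extensionality_dep => i; apply: scalerA. Qed.
Fact dscale1 : left_id 1 dscale.
Proof. by move=> x; apply: functional_extensionality_dep => i; apply: scale1r. Qed.
Fact dscaleDr : right_distributive dscale +%R.
Proof. by move=> a x y; apply: functional_extensionality_dep => i; apply: scalerDr. Qed.
Fact dscaleDl x : {morph dscale^~ x : a b / a + b}.
Proof. by move=> a b; apply: functional_extensionality_dep => i; apply: scalerDl. Qed.
HB.instance Definition _ :=
  GRing.Zmodule_isLmodule.Build R dprod dscaleA dscale1 dscaleDr dscaleDl.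

Definition dproj (i : I) (x : dprod) : Q i := x i.

Fact dproj_linear i : linear (dproj i).
Proof. by []. Qed.
HB.instance Definition _ i :=
  GRing.isLinear.Build R dprod (Q i) _ (dproj i) (dproj_linear i).

End ProductModule.

Section Adic.
Variables (R : comNzRingType) (m : {pred R}) (M : lmodType R).

Definition adic (n : nat) : {pred M} := smul (idpow m n) predT.
HB.instance Definition _ n := GRing.SubmodClosed.on (adic n).

Definition separated : Prop :=
  forall x : M, (forall n, (1 <= n)%N -> x \in adic n) -> x = 0.

Lemma idpow_sub n k : (n <= k)%N -> {subset idpow m k <= idpow m n}.
Proof.
suff idpowS i : {subset idpow m i.+1 <= idpow m i}.
  elim: k => [|k IHk]; first by rewrite leqn0 => /eqP ->.
  by rewrite leq_eqVlt => /predU1P[->//|/IHk kn] x /idpowS /kn.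
elim: i => [//|i IHi].
pose U : submodClosed R^o := smul m (idpow m i : {pred R^o}).
apply: (@lspan_min R R^o _ U) => z [a am [x xi ->]].
by apply: mem_lspan; exists a => //; exists x => //; apply: IHi.
Qed.

Lemma adic_sub n k : (n <= k)%N -> {subset adic k <= adic n}.
Proof.
move=> nk; apply: lspan_min => z [a ak [x _ ->]].
by apply: mem_lspan; exists a; [apply: idpow_sub ak | exists x].
Qed.

(* For n <= k, the projection M / m^k M -> M / m^n M (see [adic_transE]). *)
Definition adic_trans (n k : nat) (q : lquot (adic k)) : lquot (adic n) :=
  lpi (adic n) (lrep q).

Lemma adic_transE n k x : (n <= k)%N ->
  adic_trans n (lpi (adic k) x) = lpi (adic n) x.
Proof. by move=> nk; apply/lpi_eqP/(adic_sub nk)/lpi_rep. Qed.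

Definition adic_compatible : {pred dprod (fun n => lquot (adic n))} :=
  [pred x | `[< forall n k, (n <= k)%N -> adic_trans n (x k) = x n >]].

Fact adic_compatible_submod : submod_closed adic_compatible.
Proof.
split=> [|a x y /asboolP xc /asboolP yc]; apply/asboolP => n k nk.
  rewrite -[LHS]/(adic_trans n (0 : lquot (adic k))) -[RHS]/(0 : lquot (adic n)).
  by rewrite -(raddf0 (lpi (adic k))) adic_transE // raddf0.
rewrite -[RHS]/(a *: x n + y n) -(xc n k) // -(yc n k) //.
rewrite -[X in adic_trans n X]/(a *: x k + y k).
rewrite -[x k]lrepK -[y k]lrepK -linearP !adic_transE //.
exact: linearP.
Qed.
HB.instance Definition _ :=
  GRing.isSubmodClosed.Build R _ adic_compatible adic_compatible_submod.

(* The limit of the M / m^n M; the index n = 0 only adds a factor M / M. *)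
Record completion : Type := Completion {
  completion_val :> dprod (fun n => lquot (adic n));
  _ : completion_val \in adic_compatible
}.
HB.instance Definition _ := [isSub for completion_val].
HB.instance Definition _ := [Choice of completion by <:].
HB.instance Definition _ := [SubChoice_isSubLmodule of completion by <:].

Fact completion_map_subproof (x : M) :
  ((fun n => lpi (adic n) x) : dprod _) \in adic_compatible.
Proof. by apply/asboolP => n k nk; apply: adic_transE. Qed.

Definition completion_map (x : M) : completion :=
  Completion (completion_map_subproof x).

Fact completion_map_linear : linear completion_map.
Proof.
move=> a x y; apply: val_inj => /=.
by apply: functional_extensionality_dep => n; apply: linearP.
Qed.
HB.instance Definition _ :=
  GRing.isLinear.Build R M completion _ completion_map completion_map_linear.

End Adic.
Arguments completion_map {R} m M.

(* For the regular module the m-adic filtration is that of the ideals m^n. *)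
Definition complete_ring (R : comNzRingType) (m : {pred R}) : Prop :=
  bijective (completion_map m R^o).

Section Tensor.
Variables (R : comNzRingType) (A B : lmodType R).
Local Notation F := {malg R[(A * B)%type]}.
Local Notation fr a b := (<< (a, b) >> : F).

(* Relations imposed on the free R-module with basis A * B. *)
Inductive bilinear_rel : F -> Prop :=
| BilinearDl a a' b : bilinear_rel (fr (a + a') b - (fr a b + fr a' b))
| BilinearDr a b b' : bilinear_rel (fr a (b + b') - (fr a b + fr a b'))
| BilinearZl c a b : bilinear_rel (fr (c *: a) b - c *: fr a b)
| BilinearZr c a b : bilinear_rel (fr a (c *: b) - c *: fr a b).

Definition tensor : Type := lquot (lspan bilinear_rel).
HB.instance Definition _ := GRing.Lmodule.on tensor.

Definition tens (a : A) (b : B) : tensor := lpi _ (fr a b).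

Definition bilinear_map (C : lmodType R) (h : A -> B -> C) : Prop :=
  (forall b, linear (h^~ b)) /\ (forall a, linear (h a)).

Lemma tens_bilinear : bilinear_map tens.
Proof.
have subE (x y z w : F) : x - (y + w) = x - (z + w) + (z - y).
  by rewrite !opprD !addrA [x - z - w + z]addrAC subrK [RHS]addrAC.
split=> [b c a a'|a c b b']; rewrite /tens -[RHS](linearP (lpi _)).
- apply/lpi_eqP.
  have -> : fr (c *: a + a') b - (c *: fr a b + fr a' b)
      = (fr (c *: a + a') b - (fr (c *: a) b + fr a' b))
        + (fr (c *: a) b - c *: fr a b).
    exact: subE.
  apply: rpredD; apply: mem_lspan; [exact: BilinearDl|exact: BilinearZl].
- apply/lpi_eqP.
  have -> : fr a (c *: b + b') - (c *: fr a b + fr a b')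
      = (fr a (c *: b + b') - (fr a (c *: b) + fr a b'))
        + (fr a (c *: b) - c *: fr a b).
    exact: subE.
  apply: rpredD; apply: mem_lspan; [exact: BilinearDr|exact: BilinearZr].
Qed.

Section Lift.
Variables (C : lmodType R) (h : A -> B -> C).

Definition free_lift (g : F) : C := \sum_(k <- msupp g) g@_k *: h k.1 k.2.

(* Meaningful for bilinear h only: see [tensor_liftE]. *)
Definition tensor_lift (t : tensor) : C := free_lift (lrep t).

Lemma free_liftEw (g : F) (d : {fset A * B}) : (msupp g `<=` d)%fset ->
  free_lift g = \sum_(k <- d) g@_k *: h k.1 k.2.
Proof.
move=> gd; rewrite /free_lift; apply: big_fset_incl => // k _ kg.
by rewrite mcoeff_outdom // scale0r.
Qed.

Lemma free_lift_linear : linear free_lift.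
Proof.
move=> c g1 g2; pose d := (msupp g1 `|` msupp g2 `|` msupp (c *: g1 + g2))%fset.
have s1 : (msupp g1 `<=` d)%fset by rewrite /d -fsetUA fsubsetUl.
have s2 : (msupp g2 `<=` d)%fset by rewrite /d fsetUAC fsubsetUr.
have s3 : (msupp (c *: g1 + g2) `<=` d)%fset by rewrite fsubsetUr.
rewrite (free_liftEw s1) (free_liftEw s2) (free_liftEw s3).
rewrite scaler_sumr -big_split; apply: eq_bigr => k _ /=.
by rewrite mcoeffD mcoeffZ scalerDl scalerA.
Qed.
HB.instance Definition _ :=
  GRing.isLinear.Build R F C _ free_lift free_lift_linear.

Lemma free_liftU a b : free_lift (fr a b) = h a b.
Proof.
by rewrite (free_liftEw msuppU_le) big_seq_fset1 mcoeffUU scale1r.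
Qed.

Hypothesis h_bilinear : bilinear_map h.

Lemma free_lift_rel : {subset lspan bilinear_rel <= [pred g | free_lift g == 0]}.
Proof.
case: h_bilinear => hl hr g /lspanP[s [sr ->]]; rewrite inE linear_sum.
rewrite big_seq big1 // => p /sr rp; rewrite linearZ_LR /=.
suff -> : free_lift p.2 = 0 by rewrite scaler0.
case: rp => [a a' b|a b b'|c a b|c a b];
  rewrite linearB ?linearD ?linearZ_LR /= !free_liftU.
- by have := hl b 1 a a'; rewrite !scale1r => ->; rewrite -opprD subrr.
- by have := hr a 1 b b'; rewrite !scale1r => ->; rewrite -opprD subrr.
- have h0 : h 0 b = 0.
    by have := hl b (-1) 0 0; rewrite scaler0 addr0 scaleN1r addNr.
  by have := hl b c a 0; rewrite h0 !addr0 => ->; rewrite scalerN subrr.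
- have h0 : h a 0 = 0.
    by have := hr a (-1) 0 0; rewrite scaler0 addr0 scaleN1r addNr.
  by have := hr a c b 0; rewrite h0 !addr0 => ->; rewrite scalerN subrr.
Qed.

Lemma tensor_lift_pi g : tensor_lift (lpi _ g) = free_lift g.
Proof.
apply/eqP; rewrite -subr_eq0 -linearB.
exact/free_lift_rel/lpi_rep.
Qed.

Lemma tensor_lift_linear : linear tensor_lift.
Proof.
move=> c s t; rewrite -[s]lrepK -[t]lrepK -[X in tensor_lift X](linearP (lpi _)).
by rewrite !tensor_lift_pi linearP.
Qed.

Lemma tensor_liftE a b : tensor_lift (tens a b) = h a b.
Proof. by rewrite tensor_lift_pi free_liftU. Qed.

End Lift.

Lemma tensor_gen (t : tensor) :
  t \in lspan (fun s => exists a b, s = tens a b).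
Proof.
rewrite -[t]lrepK [lrep t]monalgE linear_sum /=.
apply: rpred_sum => -[a b] _.
have -> : << (lrep t)@_(a, b) *g (a, b) >> = (lrep t)@_(a, b) *: fr a b.
  by apply/malgP => k; rewrite mcoeffZ !mcoeffU mulrnAr mulr1.
by rewrite linearZ_LR; apply/rpredZ/mem_lspan; exists a, b.
Qed.

End Tensor.

Section TensorMap.
Variables (R : comNzRingType) (A A' B B' : lmodType R).
Variables (f : {linear A -> A'}) (g : {linear B -> B'}).

Definition tensor_map : tensor A B -> tensor A' B' :=
  tensor_lift (fun a b => tens (f a) (g b)).

Lemma tensor_map_bilinear : bilinear_map (fun a b => tens (f a) (g b)).
Proof.
have [tl tr] := @tens_bilinear R A' B'.
by split=> [b c a a'|a c b b']; rewrite linearP ?tl ?tr.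
Qed.

Fact tensor_map_linear : linear tensor_map.
Proof. exact: tensor_lift_linear tensor_map_bilinear. Qed.
HB.instance Definition _ :=
  GRing.isLinear.Build R (tensor A B) (tensor A' B') _ tensor_map
    tensor_map_linear.

Lemma tensor_mapE a b : tensor_map (tens a b) = tens (f a) (g b).
Proof. exact: tensor_liftE tensor_map_bilinear _ _. Qed.

End TensorMap.

Section ModuleProperties.
Variable R : comNzRingType.

Definition flat (N : lmodType R) : Prop :=
  forall (A B : lmodType R) (f : {linear A -> B}),
    injective f -> injective (tensor_map f (idfun : {linear N -> N})).

(* Purity of M in N along f; taking X := R^o shows that f is injective. *)
Definition pure (M N : lmodType R) (f : {linear M -> N}) : Prop :=
  forall X : lmodType R, injective (tensor_map (idfun : {linear X -> X}) f).

Definition totally_separated (m : {pred R}) (M : lmodType R) : Prop :=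
  forall X : lmodType R, finitely_generated X -> separated m (tensor X M).

Definition tensor_dprod (M : lmodType R) (I : Type) (Q : I -> lmodType R)
    (t : tensor M (dprod Q)) : dprod (fun i => tensor M (Q i)) :=
  fun i => tensor_map (idfun : {linear M -> M}) (dproj i) t.

Definition mittag_leffler (M : lmodType R) : Prop :=
  forall (I : Type) (Q : I -> lmodType R), injective (@tensor_dprod M I Q).

End ModuleProperties.

(* Main.v *)
Require Import Defs.
From HB Require Import structures.
From mathcomp Require Import all_boot all_order all_algebra.
From mathcomp Require Import boolp monalg.

Set Implicit Arguments.
Unset Strict Implicit.
Unset Printing Implicit Defensive.

Import GRing.Theory.
Local Open Scope ring_scope.

Local Notation span s := (lspan (fun y => y \in s)).

(** Write C for the completion of M.

    Condition (ii) is the case X = R/p of (i), since M / pM is R/p (x) M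
    ([totally_separated_prime]).

    From (ii) to (iii), let x in M lie in pC.  Modulo m^n, where M and C
    agree, x lies in p(M / m^n M), so x is in pM + m^n M for every n, and x is
    in pM because M / pM is separated ([completion_smul]).  So R/p (x) M embeds
    into R/p (x) C.  Flatness of C propagates this along a filtration with
    quotients R/p, hence to every module ([prime_separated_pure]).

    From (iii) to (i), purity embeds X (x) M into X (x) C, and it is enough
    that C be totally separated ([flat_completion_totally_separated]).  With
    X = R^b / L this says that LC is closed in C^b.  By flatness
    LC and m^k C^b meet in (L meet m^k R^b)C, which by Artin-Rees is inside
    m^n LC for k large, so approximations in LC of a given point can be
    corrected step by step and their coefficients converge in C.

    From (iii) to (iv), purity again reduces the claim to C.  An element of
    C (x) prod Q_i is given by c in C^n and vectors q_j of the product; it dies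
    in every C (x) Q_i exactly when c is in L_i C for each module L_i of
    relations, and it is zero as soon as c is in LC for L the intersection of
    the L_i.  The submodules U of R^n with c in UC are
    stable under finite intersections, so by Chevalley's theorem one of them
    lies in L + m^k R^n.  Thus c is in LC + m^k C^n for every k, and LC is
    closed ([flat_mittag_leffler]).

    From (iv) to (i), an element of M (x) X that is divisible by all powers of
    m dies in M (x) prod_n X / m^n X by the Mittag-Leffler condition.  This
    already happens with a finitely generated module N in place of M, and
    N (x) X is separated by Krull's intersection theorem
    ([mittag_leffler_totally_separated]).

    Both Artin-Rees and Chevalley's theorem are obtained in a weak form, without
    uniform exponents, by choosing maximal submodules and associated primes.
    Tensor products are handled through relations: for U inside R^n, [ext U]
    is the submodule UC of C^n, and [tensor_eq0] and [flat_eq0] say when a sum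
    of tensors vanishes in terms of it. *)

(** * Submodules and linear combinations *)

Section Submodules.
Variables (R : comNzRingType) (V : lmodType R).

(** Submodules are boolean predicates; a linear Prop-valued predicate is turned
    into one by [mksub]. *)
Definition linear_pred (P : V -> Prop) : Prop :=
  P 0 /\ forall a x y, P x -> P y -> P (a *: x + y).

Section Make.
Variables (P : V -> Prop) (Plin : linear_pred P).

Fact mksub_closed : submod_closed [pred x | `[< P x >]].
Proof.
case: Plin => P0 PD.
by split=> [|a x y /asboolP Px /asboolP Py]; apply/asboolP; auto.
Qed.

Definition mksub : submodClosed V :=
  HB.pack_for (submodClosed V) ([pred x | `[< P x >]] : V -> bool)
    (GRing.isSubmodClosed.Build R V [pred x | `[< P x >]] mksub_closed).

Lemma mksubP x : reflect (P x) (x \in mksub).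
Proof. exact: asboolP. Qed.
End Make.

Implicit Types U W : submodClosed V.

Lemma lspan_ind (S P : V -> Prop) : linear_pred P -> (forall x, S x -> P x) ->
  forall x, x \in lspan S -> P x.
Proof.
move=> Pl SP x xS; suff sub : {subset lspan S <= mksub Pl} by exact/(mksubP Pl)/sub.
by apply: lspan_min => y /SP Py; apply/(mksubP Pl).
Qed.

Fact adjoin_lin U x :
  linear_pred (fun z => exists a : R, exists2 u, u \in U & z = a *: x + u).
Proof.
split=> [|a _ _ [b [u uU ->]] [c [w wU ->]]].
  by exists 0, 0; rewrite ?rpred0 // scale0r addr0.
exists (a * b + c), (a *: u + w); first by rewrite rpredD ?rpredZ.
by rewrite scalerDr scalerDl scalerA addrACA.
Qed.
Definition adjoin U x : submodClosed V := mksub (adjoin_lin U x).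

Lemma adjoinP U x z :
  reflect (exists a : R, exists2 u, u \in U & z = a *: x + u) (z \in adjoin U x).
Proof. exact: mksubP. Qed.

Fact addmul_lin U (c : R) :
  linear_pred (fun z => exists v, exists2 u, u \in U & z = c *: v + u).
Proof.
split=> [|a _ _ [v [u uU ->]] [v' [w wU ->]]].
  by exists 0, 0; rewrite ?rpred0 // scaler0 addr0.
exists (a *: v + v'), (a *: u + w); first by rewrite rpredD ?rpredZ.
by rewrite !scalerDr !scalerA [a * c]mulrC addrACA.
Qed.
(** U + cV. *)
Definition addmul U c : submodClosed V :=
  mksub (addmul_lin U c).

Lemma addmulP U c z :
  reflect (exists v, exists2 u, u \in U & z = c *: v + u) (z \in addmul U c).
Proof. exact: mksubP. Qed.

Fact mulpre_lin U (c : R) : linear_pred (fun z => c *: z \in U).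
Proof.
split=> [/=|a y z /= yU zU]; first by rewrite scaler0 rpred0.
by rewrite scalerDr scalerA mulrC -scalerA rpredD // rpredZ.
Qed.
(** The elements carried into U by multiplication by c. *)
Definition mulpre U c : submodClosed V :=
  mksub (mulpre_lin U c).

Lemma mulpreP U c z : reflect (c *: z \in U) (z \in mulpre U c).
Proof. exact: (mksubP (mulpre_lin U c)). Qed.

Fact meetsub_lin U W : linear_pred (fun z => z \in U /\ z \in W).
Proof.
split=> [|a y z [yU yW] [zU zW]]; first by split; apply: rpred0.
by split; rewrite rpredD ?rpredZ.
Qed.
Definition meetsub U W : submodClosed V :=
  mksub (meetsub_lin U W).

Lemma meetsubP U W z : reflect (z \in U /\ z \in W) (z \in meetsub U W).
Proof. exact: mksubP. Qed.

Lemma span_sub (s : seq V) U : {subset s <= U} -> {subset span s <= U}.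
Proof. by move=> sU; apply: lspan_min. Qed.

Lemma span_mono (s t : seq V) : {subset s <= t} -> {subset span s <= span t}.
Proof.
move=> st; apply: (@span_sub s (span t)) => y /st yt; exact: mem_lspan.
Qed.

Lemma span_cons x (s : seq V) z :
  z \in span (x :: s) -> exists a : R, exists2 u, u \in span s & z = a *: x + u.
Proof.
have sub : {subset span (x :: s) <= adjoin (span s) x}.
  apply: span_sub => y; rewrite inE => /predU1P[->|ys]; apply/adjoinP.
    by exists 1, 0; rewrite ?rpred0 // scale1r addr0.
  by exists 0, y; [exact: mem_lspan | rewrite scale0r add0r].
by move=> /sub /adjoinP.
Qed.

Lemma sub_adjoin U x : {subset U <= adjoin U x}.
Proof. by move=> u uU; apply/adjoinP; exists 0, u; rewrite ?scale0r ?add0r. Qed.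

Lemma mem_adjoin U x : x \in adjoin U x.
Proof. by apply/adjoinP; exists 1, 0; rewrite ?rpred0 // scale1r addr0. Qed.

Lemma sub_addmul U c : {subset U <= addmul U c}.
Proof. by move=> u uU; apply/addmulP; exists 0, u; rewrite ?scaler0 ?add0r. Qed.

Lemma mem_addmul U c v : c *: v \in addmul U c.
Proof. by apply/addmulP; exists v, 0; rewrite ?rpred0 // addr0. Qed.

Lemma rpredBs U : {in U &, forall x y, x - y \in U}.
Proof. by move=> x y xU yU; rewrite rpredD // submod_oppr_closed. Qed.

End Submodules.

Section Colon.
Variables (R : comNzRingType) (V : lmodType R) (U : submodClosed V) (x : V).

Fact colon_lin : linear_pred (fun (a : R^o) => (a : R) *: x \in U).
Proof.
split=> [/=|a b c /= bU cU]; first by rewrite scale0r rpred0.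
by rewrite scalerDl -scalerA rpredD // rpredZ.
Qed.
(** The ideal (U : x). *)
Definition colon : submodClosed R^o := mksub colon_lin.

Lemma colonP a : reflect (a *: x \in U) (a \in colon).
Proof. exact: (mksubP colon_lin). Qed.
End Colon.

Section Kernel.
Variables (R : comNzRingType) (V W : lmodType R) (f : {linear V -> W}).

Fact kersub_lin : linear_pred (fun z => f z = 0).
Proof.
by split=> [/=|a y z /= fy fz]; rewrite ?linear0 // linearP fy fz scaler0 addr0.
Qed.
Definition kersub : submodClosed V := mksub kersub_lin.

Lemma kersubP z : reflect (f z = 0) (z \in kersub).
Proof. exact: (mksubP kersub_lin). Qed.

Fact factor_linear : linear (fun q : lquot kersub => f (lrep q)).
Proof.
move=> a x y; rewrite -linearP; apply/eqP; rewrite -subr_eq0 -linearB.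
apply/eqP.
apply/kersubP.
by apply/(lpi_eqP kersub); rewrite linearP /= !lrepK.
Qed.
(** The embedding of V / ker f into W. *)
Definition factor (q : lquot kersub) : W := f (lrep q).
HB.instance Definition _ := GRing.isLinear.Build R _ W _ factor factor_linear.

Lemma factorE v : factor (lpi kersub v) = f v.
Proof.
rewrite /factor; apply/eqP; rewrite -subr_eq0 -linearB; apply/eqP.
exact/kersubP/(lpi_rep kersub).
Qed.

Lemma factor_inj : injective factor.
Proof.
move=> p q; rewrite -[p]lrepK -[q]lrepK !factorE => eq_f.
by apply/lpi_eqP/kersubP; rewrite linearB eq_f subrr.
Qed.
End Kernel.

Lemma lpi_eq0 (R : comNzRingType) (V : lmodType R) (U : submodClosed V) v :
  reflect (lpi U v = 0) (v \in U).
Proof.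
apply: (iffP idP) => [vU|v0].
  by rewrite -[RHS](linear0 (lpi U)); apply/lpi_eqP; rewrite subr0.
by rewrite -[v]subr0; apply/lpi_eqP; rewrite v0 linear0.
Qed.

Section Lincomb.
Variables (R : comNzRingType) (V : lmodType R) (n : nat).

Definition lincomb (e : 'I_n -> V) (r : 'rV[R]_n) : V := \sum_i r 0 i *: e i.

Fact lincomb_linear e : linear (lincomb e).
Proof.
move=> a r s; rewrite /lincomb scaler_sumr -big_split; apply: eq_bigr => i _ /=.
by rewrite !mxE scalerDl scalerA.
Qed.
HB.instance Definition _ e :=
  GRing.isLinear.Build R 'rV[R]_n V _ (lincomb e) (lincomb_linear e).

Lemma lincomb_delta e i : lincomb e (delta_mx 0 i) = e i.
Proof.
rewrite /lincomb (bigD1 i) //= mxE !eqxx scale1r big1 ?addr0 // => j ji.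
by rewrite mxE (negPf ji) andbF scale0r.
Qed.

(** The coefficients of an element of IU on a generating family of U can be
    taken in I. *)
Lemma smul_coord (I : {pred R^o}) (U : {pred V}) e x : submod_closed I ->
  (forall u, u \in U -> exists r, u = lincomb e r) ->
  x \in smul I U -> exists2 r : 'rV[R]_n, (forall i, r 0 i \in I) & x = lincomb e r.
Proof.
move=> [I0 Il] Ue; pose P x := exists2 r : 'rV[R]_n,
  (forall i, r 0 i \in I) & x = lincomb e r.
have P0 : P 0 by exists 0; [move=> i; rewrite mxE | rewrite linear0].
have Pl a y z : P y -> P z -> P (a *: y + z).
  move=> [r rI ->] [s sI ->]; exists (a *: r + s); last by rewrite linearP.
  by move=> i; rewrite !mxE; apply: Il.
apply: (lspan_ind (conj P0 Pl)) => _ [a aI [u /Ue[r ->] ->]].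
exists (a *: r); last by rewrite linearZ.
by move=> i; rewrite mxE mulrC -[_ * _]addr0; apply: Il.
Qed.

End Lincomb.

Lemma span_lincomb (R : comNzRingType) (V : lmodType R) (s : seq V) x :
  x \in span s -> exists r : 'rV[R]_(size s), x = lincomb (fun i => s`_i) r.
Proof.
pose P x := exists r : 'rV[R]_(size s), x = lincomb (fun i => s`_i) r.
have P0 : P 0 by exists 0; rewrite linear0.
have Pl a y z : P y -> P z -> P (a *: y + z).
  by move=> [r ->] [t ->]; exists (a *: r + t); rewrite linearP.
apply: (lspan_ind (conj P0 Pl)) => y /(nthP 0)[i is_ <-].
by exists (delta_mx 0 (Ordinal is_)); rewrite lincomb_delta.
Qed.

(** * Noetherian modules *)

Section Noetherian.
Variable R : comNzRingType.
Hypothesis R_noeth : noetherian R.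

(** Induction on the generators: the coefficients of the elements of U at the
    first generator form an ideal; lift its generators to U and treat the part of U inside the
    span of the other generators by induction. *)
Lemma noetherian_span (V : lmodType R) (s : seq V) (U : submodClosed V) :
  {subset U <= span s} ->
  exists2 t : seq V, {subset t <= U} & {subset U <= span t}.
Proof.
elim: s U => [|x s IHs] U Us.
  by exists [::].
pose P (a : R^o) := exists2 w, w \in span s & (a : R) *: x + w \in U.
have P0 : P 0 by exists 0; rewrite ?rpred0 // scale0r addr0 rpred0.
have Pl a b c : P b -> P c -> P (a *: b + c).
  move=> [w ws wU] [v vs vU]; exists (a *: w + v); first by rewrite rpredD ?rpredZ.
  by rewrite scalerDl -scalerA addrACA -scalerDr rpredD ?rpredZ.
have [ai aiP] := R_noeth (submodClosedP (mksub (conj P0 Pl))).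
have [ti tiU tiI] : exists2 ti : seq V, {subset ti <= U} &
    forall a, a \in span ai -> exists2 w, w \in span s &
      (a : R) *: x + w \in span ti.
  have : forall a, a \in ai -> P a.
    by move=> a aai; apply/(mksubP (conj P0 Pl)); rewrite aiP mem_lspan.
  elim: ai {aiP} => [|a ai IHa] aiP.
    exists [::] => // b /lspanP[[|p q] [ps ->]]; last by have := ps p (mem_head _ _).
    by exists 0; rewrite ?rpred0 // big_nil scale0r addr0 rpred0.
  have [b bai|ti tiU tiP] := IHa; first by apply: aiP; rewrite inE bai orbT.
  have [w ws wU] := aiP a (mem_head _ _).
  exists (a *: x + w :: ti).
    by move=> y; rewrite inE => /predU1P[->|/tiU].
  have sub : {subset span ti <= span (a *: x + w :: ti)}.
    by apply: span_mono => y yt; rewrite inE yt orbT.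
  move=> _ /span_cons[c [b /tiP[v vs vt] ->]].
  exists (c *: w + v); first by rewrite rpredD ?rpredZ.
  rewrite scalerDl -scalerA addrACA -scalerDr; apply: rpredD; last exact: sub.
  by apply/rpredZ/mem_lspan; apply: mem_head.
have [|t tU tP] := IHs (meetsub U (span s)).
  by move=> y /meetsubP[].
exists (ti ++ t).
  by move=> y; rewrite mem_cat => /orP[/tiU|/tU /meetsubP[]].
have sub1 : {subset span ti <= span (ti ++ t)}.
  by apply: span_mono => y yt; rewrite mem_cat yt.
have sub2 : {subset span t <= span (ti ++ t)}.
  by apply: span_mono => y yt; rewrite mem_cat yt orbT.
move=> u uU; have /span_cons[a [w ws ue]] := Us u uU.
have : a \in span ai by rewrite -aiP; apply/mksubP; exists w; rewrite -?ue.
move=> /tiI[v vs vti].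
have -> : u = (a *: x + v) + (w - v) by rewrite ue -addrA [v + _]addrC subrK.
apply: rpredD; first exact: sub1.
apply/sub2/tP/meetsubP; split; last exact: (@rpredBs _ _ (span s)).
have -> : w - v = u - (a *: x + v) by rewrite ue opprD addrACA subrr add0r.
by apply: rpredBs => //; apply: (span_sub tiU).
Qed.

(** Otherwise choice gives a strictly increasing chain in P, whose union is
    finitely generated and hence equal to one of its terms. *)
Lemma noetherian_max (V : lmodType R) (s : seq V) (P : submodClosed V -> Prop) U0 :
  P U0 -> (forall U, P U -> {subset U <= span s}) ->
  exists2 U, P U & forall W, P W -> {subset U <= W} -> {subset W <= U}.
Proof.
move=> PU0 Ps; apply: contrapT => noMax.
have next (u : {U | P U}) : exists w : {U | P U},
    {subset sval u <= sval w} /\ ~ {subset sval w <= sval u}.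
  case: u => U PU /=; apply: contrapT => nx; apply: noMax; exists U => // W PW UW.
  by apply: contrapT => nWU; apply: nx; exists (exist _ W PW).
have [g gP] := choice next.
pose u n := iter n g (exist _ U0 PU0).
have uS n k : (n <= k)%N -> {subset sval (u n) <= sval (u k)}.
  move=> /subnK <-; elim: (k - n)%N => // i IHi y /IHi.
  exact: (gP (u (i + n)%N)).1.
pose T x := exists n, x \in sval (u n).
have T0 : T 0 by exists 0%N; rewrite rpred0.
have Tl a x y : T x -> T y -> T (a *: x + y).
  move=> [n xn] [k yk]; exists (maxn n k).
  by rewrite rpredD ?rpredZ ?(uS _ _ (leq_maxl n k) x) ?(uS _ _ (leq_maxr n k) y).
have [|t tT Tt] := @noetherian_span V s (mksub (conj T0 Tl)).
  by move=> x /mksubP[n xn]; apply: (Ps (sval (u n))) xn; apply: svalP.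
have [n tn] : exists n, {subset t <= sval (u n)}.
  elim: t tT {Tt} => [|y t IHt] tT; first by exists 0%N.
  have [x xt|n tn] := IHt; first by apply: tT; rewrite inE xt orbT.
  have /mksubP[k yk] := tT y (mem_head _ _).
  exists (maxn n k) => x; rewrite inE => /predU1P[->|/tn].
    exact: uS (leq_maxr n k) _ yk.
  exact: uS (leq_maxl n k) _.
apply: (gP (u n)).2 => x xn; apply: (span_sub tn); apply: Tt.
by apply/mksubP; exists n.+1.
Qed.

Lemma ideal_max (P : submodClosed R^o -> Prop) U0 : P U0 ->
  exists2 U, P U & forall W, P W -> {subset U <= W} -> {subset W <= U}.
Proof.
move=> PU0; apply: (noetherian_max (s := [:: 1 : R^o]) PU0) => U _ x _.
rewrite -[x]mulr1 -[_ * 1]/(x *: (1 : R^o)).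
by apply/rpredZ/mem_lspan; apply: mem_head.
Qed.

(** Every nonzero element of V / U has a multiple whose annihilator is prime: a
    maximal one among the annihilators of its nonzero multiples. *)
Lemma assoc_prime (V : lmodType R) (U : submodClosed V) x : x \notin U ->
  exists (p : prime_idealr R) (a : R), forall c, (c \in p) = (c *: (a *: x) \in U).
Proof.
move=> xU.
have [|W [a aU WE] Wmax] :=
  @ideal_max (fun W => exists2 a : R, a *: x \notin U & W = colon U (a *: x)) (colon U x).
  by exists 1; rewrite scale1r.
pose S : {pred R} := [pred c | c *: (a *: x) \in U].
have SW c : (c \in S) = (c \in W).
  by rewrite WE; apply/idP/colonP.
have idS : idealr_closed S.
  split; first by rewrite inE scale0r rpred0.
    by rewrite inE scale1r.
  move=> c u v; rewrite !inE => uU vU.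
  by rewrite scalerDl -scalerA rpredD // rpredZ.
have prS : prime_idealr_closed S.
  move=> c d; rewrite inE -scalerA => cd.
  have [dS|dS] := boolP (d \in S); rewrite ?orbT // orbF SW.
  apply: (Wmax (colon U (d *: (a *: x)))).
  - by exists (d * a); rewrite -scalerA.
  - by move=> e; rewrite -SW => eS; apply/colonP; rewrite scalerA mulrC -scalerA rpredZ.
  - exact/colonP.
pose p : prime_idealr R := HB.pack_for (prime_idealr R) (S : R -> bool)
  (isIdealr.Build R S idS) (isPrimeIdealrClosed.Build R S prS).
by exists p, a.
Qed.

End Noetherian.


(** * Adic filtrations over a local ring *)

Section Adic.
Variables (R : comNzRingType) (m : {pred R}).
Local Notation adicm V n := (@adic R m V n).

Lemma idpow_submod n : submod_closed (idpow m n : {pred R^o}).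
Proof. by case: n => [|n] //; apply: lspan_submod_closed. Qed.

Lemma exp_idpow a n : a \in m -> a ^+ n \in idpow m n.
Proof.
move=> am; elim: n => [//|n IHn]; rewrite exprS.
by apply: (@mem_lspan R R^o); exists a => //; exists (a ^+ n).
Qed.

Lemma mem_adic (V : lmodType R) n a (v : V) : a \in idpow m n -> a *: v \in adicm V n.
Proof. by move=> an; apply: mem_lspan; exists a => //; exists v. Qed.

Lemma adic_ring n a : (a \in adicm R^o n) = (a \in idpow m n).
Proof.
apply/idP/idP => [|an]; last by rewrite -[a]mulr1; apply: (mem_adic (1 : R^o)).
have Hl := idpow_submod n.
apply: (@lspan_ind R R^o _ _ Hl) => _ [b bn [x _ ->]].
by rewrite [_ *: _]mulrC -[_ * _]addr0; apply: Hl.2 => //; apply: Hl.1.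
Qed.

Lemma adic_linear (V W : lmodType R) (f : {linear V -> W}) n v :
  v \in adicm V n -> f v \in adicm W n.
Proof.
have Hl : linear_pred (fun v => f v \in adicm W n).
  split=> [|a x y fx fy]; first by rewrite linear0 rpred0.
  by rewrite linearP rpredD // rpredZ.
apply: (lspan_ind Hl) => _ [a an [x _ ->]].
by rewrite linearZ; apply: mem_adic.
Qed.

Lemma separated_inj (V W : lmodType R) (f : {linear V -> W}) :
  injective f -> separated m W -> separated m V.
Proof.
move=> f_inj Wsep v v_adic; apply: f_inj; rewrite linear0; apply: Wsep => n n0.
exact/adic_linear/v_adic.
Qed.

Fact add_adic_lin (V : lmodType R) (U : submodClosed V) n :
  linear_pred (fun x => exists2 u, u \in U & x - u \in adicm V n).
Proof.
split=> [|a x y [u uU xu] [w wU yw]]; first by exists 0; rewrite ?subr0 rpred0.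
exists (a *: u + w); first by rewrite rpredD ?rpredZ.
by rewrite opprD addrACA -scalerBr rpredD // rpredZ.
Qed.

(** U + m^n V. *)
Definition add_adic (V : lmodType R) (U : submodClosed V) n : submodClosed V :=
  mksub (add_adic_lin U n).

Lemma add_adicP (V : lmodType R) (U : submodClosed V) n x :
  reflect (exists2 u, u \in U & x - u \in adicm V n) (x \in add_adic U n).
Proof. exact: mksubP. Qed.

Lemma add_adic_mono (V : lmodType R) (U W : submodClosed V) n :
  {subset U <= W} -> {subset add_adic U n <= add_adic W n}.
Proof.
move=> UW x /add_adicP[u /UW uW xu].
by apply/add_adicP; exists u.
Qed.

End Adic.

Section Local.
Variables (R : comNzRingType) (m : {pred R}).
Local Notation adicm V n := (@adic R m V n).
Hypotheses (R_noeth : noetherian R) (R_local : local_ring m).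

Lemma m_ideal : idealr_closed m.
Proof. exact: R_local.1.1. Qed.

Lemma m_submod : submod_closed (m : {pred R^o}).
Proof. by have [m0 _ ml] := m_ideal; split=> // a x y xm ym; apply: ml. Qed.

(** Otherwise r lies in a maximal proper ideal, which is m. *)
Lemma local_unit r : r \notin m -> exists b, b * r = 1.
Proof.
move=> rm; apply: contrapT => nu.
have [|W [rW W1] Wmax] :=
  @ideal_max R R_noeth (fun W => (r : R^o) \in W /\ 1 \notin W)
    (lspan (fun y : R^o => y = r)).
  split; first exact: mem_lspan.
  apply/negP => r1; apply: nu.
  have Hl : linear_pred (V := R^o) (fun c => exists b, b * r = c).
    split=> [|a _ _ [b <-] [c <-]]; first by exists 0; rewrite mul0r.
    by exists (a * b + c); rewrite mulrDl -mulrA.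
  by apply: (lspan_ind Hl _ r1) => _ ->; exists 1; rewrite mul1r.
suff /(R_local.2 _) WE : maximal_ideal (W : {pred R}).
  by move: rm; rewrite -WE rW.
split.
  by split=> // [|a u v uW vW]; [exact: (rpred0 W) | exact: (submodClosedP W).2].
move=> J [J0 J1 Jl] WJ.
have Hl : linear_pred (V := R^o) (fun c => c \in J) by split.
have sub : {subset J <= mksub Hl} by move=> x xJ; apply/(mksubP Hl).
move=> x /sub xJ; apply: (Wmax (mksub Hl)) xJ; last by move=> y /WJ /sub.
by split; [apply/(mksubP Hl)/WJ | apply: contra J1 => /(mksubP Hl)].
Qed.

Lemma prime_exp (p : prime_idealr R) a j : a ^+ j \in p -> a \in p.
Proof.
elim: j => [|j IHj]; first by rewrite expr0 idealr1.
by rewrite exprS prime_idealrM => /orP[].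
Qed.

(** Elements outside m are invertible, so no proper ideal contains m strictly. *)
Lemma prime_eq_m (p : prime_idealr R) : {subset m <= p} -> p =i m.
Proof.
move=> mp x; apply/idP/idP => [xp|/mp //]; apply: contraT => /local_unit[b bx].
by rewrite -(idealr1 p) -bx mulrC prime_idealrM xp.
Qed.

Lemma fg_max (V : lmodType R) (P : submodClosed V -> Prop) U0 :
  finitely_generated V -> P U0 ->
  exists2 U, P U & forall W, P W -> {subset U <= W} -> {subset W <= U}.
Proof.
by move=> [s Vs] PU0; apply: (noetherian_max R_noeth (s := s) PU0) => U _ x _.
Qed.

Section FG.
Variables (V : lmodType R) (V_fg : finitely_generated V).
Implicit Types U W K L : submodClosed V.

(** If every element of m acts nilpotently on V / K, then m itself does.  Take U
    maximal among the submodules above K that some power of m sends into K.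
    Were U not all of V, an associated prime of V / U would contain m, and U
    could be enlarged. *)
Lemma nilpotent_action K :
  (forall a, a \in m -> exists j, forall v, a ^+ j *: v \in K) ->
  exists k, {subset adicm V k <= K}.
Proof.
move=> Knil.
have [|U [KU [k kU]] Umax] := @fg_max V (fun U => {subset K <= U} /\
    exists k, forall a, a \in idpow m k -> forall u, u \in U -> a *: u \in K) K V_fg.
  by split=> //; exists 0%N => a _ u uK; rewrite rpredZ.
exists k; apply: lspan_min => _ [a ak [v _ ->]]; apply: (kU) => //.
apply: contraT => /(assoc_prime R_noeth)[p [b pE]].
have mp : {subset m <= p}.
  move=> c /[dup] cm /Knil[j cj]; apply: (@prime_exp _ _ j).
  by rewrite pE; apply: KU.
rewrite -(idealr1 p) pE scale1r; apply: (Umax (adjoin U (b *: v))); last first.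
- exact: mem_adjoin.
- exact: sub_adjoin.
split; first by move=> x /KU; apply: sub_adjoin.
exists k.+1 => c ck u /adjoinP[d [w wU ->]].
have Hl : linear_pred (V := R^o) (fun c => (c : R) *: (d *: (b *: v) + w) \in K).
  split=> [/=|c1 c2 c3 /= h2 h3]; first by rewrite scale0r rpred0.
  by rewrite scalerDl -scalerA rpredD // rpredZ.
apply: (@lspan_ind R R^o _ _ Hl _ c ck) => _ [e em [f fk ->]].
rewrite [_ *: f]mulrC -scalerA; apply: (kU) => //.
rewrite scalerDr; apply: rpredD; last exact: rpredZ.
by rewrite scalerA mulrC -scalerA rpredZ // -pE mp.
Qed.

(** A weak Artin-Rees lemma: the m-adic topology of V induces the one of L.
    Let K be maximal among the submodules that meet L in N = m^n L.  For a in m,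
    let j be such that a^(j+i) v in K implies a^j v in K.  Any x in L of the
    form z + a^j v with z in K has a^n x in N, so a^(n+j) v and then a^j v is in
    K, and x is in N; hence K + a^j V meets L in N too, and a^j V lies in K by
    maximality.  Then [nilpotent_action] puts some m^k V inside K. *)
Lemma artin_rees L n : exists k, forall x,
  x \in adicm V k -> x \in L -> x \in smul (idpow m n) L.
Proof.
pose N : submodClosed V := smul (idpow m n) L.
have NL : {subset N <= L}.
  by apply: lspan_min => _ [a _ [x xL ->]]; rewrite rpredZ.
have [|K [NK KN] Kmax] := @fg_max V (fun K => {subset N <= K} /\
    forall x, x \in K -> x \in L -> x \in N) N V_fg.
  by split.
suff [k kK] : exists k, {subset adicm V k <= K}.
  by exists k => x /kK xK; apply: KN.
apply: nilpotent_action => a am.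
have [|W [j WE] Wmax] := @fg_max V (fun W => exists j, W = mulpre K (a ^+ j))
    (mulpre K 1) V_fg.
  by exists 0%N; rewrite expr0.
exists j => v; apply: (Kmax (addmul K (a ^+ j))); last exact: mem_addmul.
  split=> [x /NK|]; first exact: sub_addmul.
  move=> _ /addmulP[w [z zK ->]] xL; apply: KN => //.
  rewrite rpredD //; apply/mulpreP; rewrite -WE.
  apply: (Wmax (mulpre K (a ^+ (n + j)))).
  - by exists (n + j)%N.
  - move=> x; rewrite WE => /mulpreP xK.
    by apply/mulpreP; rewrite exprD -scalerA rpredZ.
  apply/mulpreP; rewrite exprD -scalerA.
  rewrite -[_ *: (_ *: w)](addrK (a ^+ n *: z)) -scalerDr.
  apply: rpredBs; last exact: rpredZ.
  apply/NK/mem_lspan; exists (a ^+ n); first exact: exp_idpow.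
  by exists (a ^+ j *: w + z).
exact: sub_addmul.
Qed.

(** If x is in every m^n V, Artin-Rees for L = Rx gives x = r x with r in m, and
    1 - r is invertible. *)
Lemma krull : separated m V.
Proof.
move=> x xadic.
have [k kP] := artin_rees (lspan (fun y => y = x)) 1.
have /kP : x \in adicm V k by apply: adic_sub (leqnSn k) _ (xadic _ _).
move=> /(_ (mem_lspan (erefl x))).
have : forall u, u \in lspan (fun y => y = x) ->
    exists r, u = lincomb (fun _ : 'I_1 => x) r.
  have Hl : linear_pred (fun u => exists r, u = lincomb (fun _ : 'I_1 => x) r).
    split=> [|a _ _ [r ->] [s ->]]; first by exists 0; rewrite linear0.
    by exists (a *: r + s); rewrite linearP.
  apply: (lspan_ind Hl) => _ ->; exists (delta_mx 0 0).
  by rewrite lincomb_delta.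
move=> /(smul_coord (idpow_submod m 1)) sc /sc[r /(_ 0) rm].
rewrite /lincomb big_ord1 => xr.
have r0m : r 0 0 \in m.
  have Hl : linear_pred (V := R^o) (fun c => c \in m) := m_submod.
  apply: (@lspan_ind R R^o _ _ Hl _ _ rm) => _ [a am [b _ ->]].
  by rewrite [_ *: _]mulrC -[_ * _]addr0; apply: Hl.2 => //; apply: Hl.1.
have /local_unit[b b1] : 1 - r 0 0 \notin m.
  have [m0 m1 ml] := m_ideal; apply: contra m1 => r1.
  by rewrite -(subrK (r 0 0) 1) -[1 - _]mul1r; apply: ml.
by rewrite -[x]scale1r -b1 -scalerA scalerBl scale1r -xr subrr scaler0.
Qed.

End FG.

Lemma lquot_fg (V : lmodType R) (U : submodClosed V) :
  finitely_generated V -> finitely_generated (lquot U).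
Proof.
move=> [s Vs]; exists (map (lpi U) s) => q; rewrite -[q]lrepK.
have Hl : linear_pred (fun v => lpi U v \in span (map (lpi U) s)).
  split=> [|a x y fx fy]; first by rewrite linear0 rpred0.
  by rewrite linearP rpredD // rpredZ.
apply: (lspan_ind Hl _ (Vs (lrep q))) => v vs; apply: mem_lspan.
exact: map_f.
Qed.

Lemma krull_closed (V : lmodType R) (U : submodClosed V) v :
  finitely_generated V -> (forall n, v \in add_adic m U n) -> v \in U.
Proof.
move=> Vfg vU; apply/lpi_eq0; apply: (krull (lquot_fg U Vfg)) => n _.
have /add_adicP[u uU vu] := vU n.
have -> : lpi U v = lpi U (v - u) by apply/lpi_eqP; rewrite opprB addrC subrK.
exact: adic_linear.
Qed.

Section Chevalley.
Variables (V : lmodType R) (V_fg : finitely_generated V).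
Variables (F : submodClosed V -> Prop) (U0 : submodClosed V) (F0 : F U0).
Hypothesis F_directed : forall U W, F U -> F W ->
  exists X, [/\ F X, {subset X <= U} & {subset X <= W}].

(** V / m^n V is artinian: the family of all U + m^n V, U in F, has a least
    member.  The property is proved for the traces on a submodule T, taken
    maximal.  If T is not V, then T + Ry with (T : y) = m has one composition
    factor more.  Either some member of F gains nothing on T + Ry, or every
    member contains y up to an element of T; in both cases the least trace on T
    gives one on T + Ry. *)
Lemma directed_dcc n :
  exists2 U, F U & forall W, F W -> {subset U <= add_adic m W n}.
Proof.
pose good (T : submodClosed V) := exists2 U, F U & forall W, F W -> forall x,
  x \in T -> x \in add_adic m U n -> x \in add_adic m W n.
have [|T [nT [U FU UP]] Tmax] := @fg_max V (fun T =>
    {subset adicm V n <= T} /\ good T) (adicm V n) V_fg.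
  split=> //; exists U0 => // W FW x xn _.
  by apply/add_adicP; exists 0; rewrite ?rpred0 // subr0.
suff TV v : v \in T.
  exists U => // W FW x xU; apply: (UP W FW x (TV x)).
  by apply/add_adicP; exists x; rewrite // subrr rpred0.
apply: contraT => /(assoc_prime R_noeth)[p [a pE]].
set y := a *: v in pE.
have pm : p =i m.
  apply: prime_eq_m => c cm; apply: (@prime_exp _ _ n).
  by rewrite pE; apply/nT/mem_adic/exp_idpow.
rewrite -(idealr1 p) pE scale1r; apply: (Tmax (adjoin T y)); last first.
- exact: mem_adjoin.
- exact: sub_adjoin.
split; first by move=> x /nT; apply: sub_adjoin.
have [[U1 FU1 noU1]|allU] := pselect (exists2 U1, F U1 & forall x,
    x \in adjoin T y -> x \in add_adic m U1 n -> x \in T).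
  have [X [FX XU XU1]] := F_directed FU FU1; exists X => // W FW x xT xX.
  apply: UP => //; first by apply: noU1 => //; apply: add_adic_mono xX.
  exact: add_adic_mono xX.
have yF W : F W -> exists2 u, u \in T & y + u \in add_adic m W n.
  move=> FW; apply: contrapT => nW; apply: allU; exists W => // x.
  move=> /adjoinP[r [u uT ->]] xW.
  have [ryT|ryT] := boolP (r *: y \in T); first by rewrite rpredD.
  have /local_unit[b br] : r \notin m by rewrite -pm pE.
  case: nW; exists (b *: u); first by rewrite rpredZ.
  by rewrite -[y]scale1r -br -scalerA -scalerDr rpredZ.
exists U => // W FW _ /adjoinP[r [u uT ->]] xU.
have [X [FX XU XW]] := F_directed FU FW.
have [u' u'T yX] := yF X FX.
apply: (add_adic_mono XW).
have -> : r *: y + u = (u - r *: u') + r *: (y + u').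
  by rewrite scalerDr [_ + r *: u']addrC addrA subrK addrC.
rewrite rpredD //; last by rewrite rpredZ.
apply: UP => //; first by rewrite rpredBs ?rpredZ.
have -> : u - r *: u' = (r *: y + u) - r *: (y + u').
  by rewrite scalerDr opprD addrACA subrr add0r.
by rewrite rpredBs // rpredZ //; apply: add_adic_mono yX.
Qed.

Hypothesis R_complete : forall r : nat -> R,
  (forall n, r n.+1 - r n \in idpow m n) ->
  exists l, forall n, l - r n \in idpow m n.

(** Summing the increments coefficientwise reduces convergence in V to
    convergence in R. *)
Lemma fg_complete (s : nat -> V) : (forall n, s n.+1 - s n \in adicm V n) ->
  exists l, forall n, l - s n \in adicm V n.
Proof.
have [g Vg] := V_fg; pose e (i : 'I_(size g)) := g`_i.
have Ve v : exists r, v = lincomb e r by apply: span_lincomb.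
move=> sP.
have : forall n, exists r : 'rV[R]_(size g),
    (forall i, r 0 i \in idpow m n) /\ s n.+1 - s n = lincomb e r.
  move=> n; have Ve' u : u \in (predT : {pred V}) -> exists r, u = lincomb e r.
    by move=> _; apply: Ve.
  by have [r rn ->] := smul_coord (idpow_submod m n) Ve' (sP n); exists r.
move=> /choice[d dP]; have [r0 r0E] := Ve (s 0%N).
pose r n := r0 + \sum_(k < n) d k.
have rS n : r n.+1 = r n + d n by rewrite /r big_ord_recr addrA.
have sE n : s n = lincomb e (r n).
  elim: n => [|n IHn]; first by rewrite /r big_ord0 addr0.
  by rewrite rS linearD /= -IHn -(dP n).2 addrC subrK.
have : forall i, exists l, forall n, l - r n 0 i \in idpow m n.
  move=> i; apply: R_complete => n.
  by rewrite rS [(r n + d n) 0 i]mxE addrAC subrr add0r (dP n).1.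
move=> /choice[l lP]; exists (lincomb e (\row_i l i)) => n.
rewrite sE -linearB; apply: rpred_sum => i _; apply: mem_adic.
by rewrite [(_ - r n) 0 i]mxE [(- r n) 0 i]mxE mxE lP.
Qed.

(** Chevalley's theorem: modulo m^k V, some member of F is contained in the
    intersection of F.  Let A_n be the intersection of all U + m^n V, U in F.
    By [directed_dcc], A_n is inside A_(n+1) + m^n V, so a point of A_k can be
    corrected successively to a limit w with w in U + m^n V for all n and U,
    and then w is in every U by Krull. *)
Lemma chevalley k : exists2 U, F U & forall u, u \in U ->
  exists2 w, (forall W, F W -> w \in W) & u - w \in adicm V k.
Proof.
pose A n x := forall W, F W -> x \in add_adic m W n.
have AS n x : exists y, A n x -> A n.+1 y /\ y - x \in adicm V n.
  have [Ax|] := pselect (A n x); last by exists 0.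
  have [U FU UP] := directed_dcc n.+1.
  have /add_adicP[u uU xu] := Ax U FU.
  exists u => _; split; first by move=> W FW; apply: UP.
  by rewrite -opprB submod_oppr_closed.
have /choice[g gP] : forall n, exists g : V -> V, forall x,
    A n x -> A n.+1 (g x) /\ g x - x \in adicm V n.
  by move=> n; have [g gP] := choice (AS n); exists g.
have [U FU UP] := directed_dcc k; exists U => // u uU.
(* t i lies in A_(k+i); it is shifted by k, so that the n-th step is in m^n V. *)
pose t := fix t i := if i is i'.+1 then g (k + i')%N (t i') else u.
have tA i : A (k + i)%N (t i).
  elim: i => [|i IHi]; first by rewrite addn0 => W FW; apply: UP.
  by rewrite addnS; apply: (gP _ _ IHi).1.
have [|w wP] := @fg_complete (fun n => t (n - k)%N).
  move=> n; have [kn|nk] := leqP k n.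
    by rewrite subSn //= subnKC //; have := (gP _ _ (tA (n - k)%N)).2; rewrite subnKC.
  by rewrite (eqP (nk : (n.+1 - k)%N == 0%N)) (eqP (ltnW nk : (n - k)%N == 0%N)) subrr rpred0.
exists w; last by rewrite -opprB submod_oppr_closed //; have := wP k; rewrite subnn.
move=> W FW; apply: krull_closed => // n.
suff : w \in add_adic m W (k + n)%N.
  move=> /add_adicP[v vW wv]; apply/add_adicP.
  by exists v => //; apply: adic_sub wv; apply: leq_addl.
have := wP (k + n)%N; rewrite addKn => wt.
have /add_adicP[v vW tv] := tA n W FW.
apply/add_adicP; exists v => //.
by rewrite -[w](subrK (t n)) -addrA rpredD.
Qed.

End Chevalley.
End Local.


(** * Sums of tensors *)

Section TensorTheory.
Variables (R : comNzRingType) (A B : lmodType R).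

(** The theory of linear maps applies to [tens] through these partial applications. *)
Definition tensl (b : B) (a : A) : tensor A B := tens a b.
Fact tensl_linear b : linear (tensl b).
Proof. exact: (tens_bilinear A B).1. Qed.
HB.instance Definition _ b := GRing.isLinear.Build R A _ _ (tensl b) (tensl_linear b).

Definition tensr (a : A) (b : B) : tensor A B := tens a b.
Fact tensr_linear a : linear (tensr a).
Proof. exact: (tens_bilinear A B).2. Qed.
HB.instance Definition _ a := GRing.isLinear.Build R B _ _ (tensr a) (tensr_linear a).

Lemma tensZl c (a : A) (b : B) : tens (c *: a) b = c *: tens a b.
Proof. by rewrite -[LHS]/(tensl b (c *: a)) linearZ. Qed.

Lemma tensZr c (a : A) (b : B) : tens a (c *: b) = c *: tens a b.
Proof. by rewrite -[LHS]/(tensr a (c *: b)) linearZ. Qed.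

Lemma tensDl (a a' : A) (b : B) : tens (a + a') b = tens a b + tens a' b.
Proof. by rewrite -[LHS]/(tensl b (a + a')) linearD. Qed.

Lemma tensPl c (a a' : A) (b : B) : tens (c *: a + a') b = c *: tens a b + tens a' b.
Proof. exact: (tens_bilinear A B).1. Qed.

Lemma tensPr c (a : A) (b b' : B) : tens a (c *: b + b') = c *: tens a b + tens a b'.
Proof. exact: (tens_bilinear A B).2. Qed.

Lemma tens0l (b : B) : tens (0 : A) b = 0.
Proof. exact: linear0 (tensl b). Qed.

Lemma tens_eq0l (a : A) (b : B) : a = 0 -> tens a b = 0.
Proof. by move=> ->; apply: tens0l. Qed.

Lemma tens0r (a : A) : tens a (0 : B) = 0.
Proof. exact: linear0 (tensr a). Qed.

Lemma tens_sumB n (x : 'I_n -> A) (y z : 'I_n -> B) t :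
  \sum_i tens (x i) (y i) = t -> \sum_i tens (x i) (z i) = t ->
  \sum_i tens (x i) (y i - z i) = 0.
Proof.
move=> yt zt.
transitivity (\sum_i tens (x i) (y i) - \sum_i tens (x i) (z i)); last first.
  exact: etrans (congr2 (fun u v => u - v) yt zt) (subrr t).
rewrite -sumrB; apply: eq_bigr => i _.
by rewrite -[LHS]/(tensr (x i) (y i - z i)) linearB.
Qed.

Lemma tens_swap_scale c (a : A) (b : B) : tens (c *: a) b = tens a (c *: b).
Proof. by rewrite tensZl tensZr. Qed.

Lemma tens_lincomb n (e : 'I_n -> A) r (b : B) :
  tens (lincomb e r) b = \sum_i tens (e i) (r 0 i *: b).
Proof.
rewrite -[LHS]/(tensl b (lincomb e r)) linear_sum; apply: eq_bigr => i _.
exact: tens_swap_scale.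
Qed.

Lemma tens_swap_bilinear : bilinear_map (fun (a : A) (b : B) => (tens b a : tensor B A)).
Proof. by have [l r] := tens_bilinear B A; split. Qed.

Definition tswap : tensor A B -> tensor B A := tensor_lift (fun a b => tens b a).
Fact tswap_linear : linear tswap.
Proof. exact: tensor_lift_linear tens_swap_bilinear. Qed.
HB.instance Definition _ :=
  GRing.isLinear.Build R (tensor A B) (tensor B A) _ tswap tswap_linear.
Lemma tswapE a b : tswap (tens a b) = tens b a.
Proof. exact: tensor_liftE tens_swap_bilinear _ _. Qed.

Lemma tensor_sum (t : tensor A B) :
  exists n (x : 'I_n -> A) (y : 'I_n -> B), t = \sum_i tens (x i) (y i).
Proof.
have /lspanP[s [sP ->]] := tensor_gen t.
have : exists u : seq (A * B), \sum_(p <- s) p.1 *: p.2 = \sum_(p <- u) tens p.1 p.2.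
  elim: s sP => [|p s IHs] sP; first by exists [::]; rewrite !big_nil.
  have [q qs|u uE] := IHs; first by apply: sP; rewrite inE qs orbT.
  have [a [b pE]] := sP p (mem_head _ _); exists ((p.1 *: a, b) :: u).
  by rewrite !big_cons uE pE tensZl.
case=> u ->; exists (size u), (fun i => (nth (0, 0) u i).1), (fun i => (nth (0, 0) u i).2).
by rewrite (big_nth (0, 0)) big_mkord.
Qed.

Section Gen.
Variables (n : nat) (e : 'I_n -> A) (Ae : forall a, exists r, a = lincomb e r).

Lemma tensor_coord (t : tensor A B) : exists c, t = \sum_i tens (e i) (c i).
Proof.
have Hl : linear_pred (fun t : tensor A B => exists c, t = \sum_i tens (e i) (c i)).
  split=> [|a _ _ [c ->] [d ->]].
    by exists (fun=> 0); rewrite big1 // => i _; apply: tens0r.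
  exists (fun i => a *: c i + d i); rewrite scaler_sumr -big_split.
  by apply: eq_bigr => i _ /=; rewrite -[RHS]/(tensr (e i) _) linearP.
apply: (lspan_ind Hl _ (tensor_gen t)) => _ [a [b ->]].
by have [r ->] := Ae a; exists (fun i => r 0 i *: b); rewrite tens_lincomb.
Qed.

Lemma tensor_coord_adic m k t : t \in @adic R m (tensor A B) k ->
  exists2 c, (forall i, c i \in @adic R m B k) & t = \sum_i tens (e i) (c i).
Proof.
have Hl : linear_pred (fun t : tensor A B =>
    exists2 c, (forall i, c i \in @adic R m B k) & t = \sum_i tens (e i) (c i)).
  split=> [|a _ _ [c cP ->] [d dP ->]].
    exists (fun=> 0); first by move=> _; apply: rpred0.
    by rewrite big1 // => i _; apply: tens0r.
  exists (fun i => a *: c i + d i); first by move=> i; rewrite rpredD ?rpredZ.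
  rewrite scaler_sumr -big_split.
  by apply: eq_bigr => i _ /=; rewrite -[RHS]/(tensr (e i) _) linearP.
apply: (lspan_ind Hl) => _ [a ak [s _ ->]].
have [c ->] := tensor_coord s.
exists (fun i => a *: c i); first by move=> i; apply: mem_adic.
rewrite scaler_sumr; apply: eq_bigr => i _.
by rewrite tensZr.
Qed.
End Gen.

End TensorTheory.

Lemma tensor_map_sum (R : comNzRingType) (A A' B B' : lmodType R)
    (f : {linear A -> A'}) (g : {linear B -> B'}) n (x : 'I_n -> A) (y : 'I_n -> B) :
  tensor_map f g (\sum_i tens (x i) (y i)) = \sum_i tens (f (x i)) (g (y i)).
Proof.
by rewrite [LHS]linear_sum; apply: eq_bigr => i _; exact: tensor_mapE.
Qed.

Lemma tensor_map_eq0 (R : comNzRingType) (A A' B B' : lmodType R)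
    (f : {linear A -> A'}) (g : {linear B -> B'}) n (x : 'I_n -> A) (y : 'I_n -> B) :
  \sum_i tens (x i) (y i) = 0 -> \sum_i tens (f (x i)) (g (y i)) = 0.
Proof. by move=> xy0; rewrite -tensor_map_sum xy0 linear0. Qed.

Section PairInjections.
Variables (R : comNzRingType) (V W : lmodType R).
Definition inj1 (x : V) : (V * W)%type := (x, 0).
Fact inj1_linear : linear inj1.
Proof. by move=> a x y; congr pair; rewrite /= scaler0 addr0. Qed.
HB.instance Definition _ := GRing.isLinear.Build R V _ _ inj1 inj1_linear.
Definition inj2 (x : W) : (V * W)%type := (0, x).
Fact inj2_linear : linear inj2.
Proof. by move=> a x y; congr pair; rewrite /= scaler0 addr0. Qed.
HB.instance Definition _ := GRing.isLinear.Build R W _ _ inj2 inj2_linear.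
End PairInjections.
Arguments inj1 {R V} W x.
Arguments inj2 {R} V {W} x.

Lemma lincomb_map (R : comNzRingType) (V W : lmodType R) (f : {linear V -> W}) n
  (e : 'I_n -> V) r : lincomb (f \o e) r = f (lincomb e r).
Proof. by rewrite linear_sum; apply: eq_bigr => i _; rewrite linearZ. Qed.

(** * Extended submodules and relations between tensors *)

Section Ext.
Variables (R : comNzRingType) (C : lmodType R) (n : nat).
Local Notation Cn := (dprod (fun _ : 'I_n => C)).
Implicit Types (U W : submodClosed 'rV[R]_n) (c : Cn).

Lemma dprodP (x y : Cn) : (forall i, x i = y i) -> x = y.
Proof. exact: functional_extensionality_dep. Qed.

Definition rowmul (r : 'rV[R]_n) (d : C) : Cn := fun i => r 0 i *: d.

Lemma rowmulP a r s d : rowmul (a *: r + s) d = a *: rowmul r d + rowmul s d.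
Proof.
apply: dprodP => i.
by rewrite /rowmul !mxE scalerDl -scalerA.
Qed.

Lemma rowmulB r s d : rowmul (r - s) d = rowmul r d - rowmul s d.
Proof. by rewrite addrC -scaleN1r rowmulP scaleN1r addrC. Qed.

(** The submodule UC of C^n, the image of U (x) C. *)
Definition ext (U : {pred 'rV[R]_n}) : {pred Cn} :=
  lspan (fun z => exists2 r, r \in U & exists d, z = rowmul r d).
HB.instance Definition _ U := GRing.SubmodClosed.on (ext U).

Lemma mem_ext (U : {pred 'rV[R]_n}) r d : r \in U -> rowmul r d \in ext U.
Proof. by move=> rU; apply: mem_lspan; exists r => //; exists d. Qed.

Lemma ext_mono (U W : {pred 'rV[R]_n}) : {subset U <= W} -> {subset ext U <= ext W}.
Proof.
move=> UW; apply: (@lspan_min _ _ _ (ext W)) => _ [r rU [d ->]].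
exact/mem_ext/UW.
Qed.

Lemma dprod_sumE (J : Type) (s : seq J) (F : J -> Cn) i :
  (\sum_(j <- s) F j) i = \sum_(j <- s) F j i.
Proof. exact: (linear_sum (dproj (Q := fun _ : 'I_n => C) i)). Qed.

Lemma Cn_delta c : c = \sum_i rowmul (delta_mx 0 i) (c i).
Proof.
apply: dprodP => j; rewrite dprod_sumE (bigD1 j) //=.
rewrite big1 ?addr0; first by rewrite /rowmul mxE !eqxx scale1r.
by move=> i ij; rewrite /rowmul mxE eq_sym (negPf ij) scale0r.
Qed.

(** The coordinate c_i is a sum of products a d with a in m^k, and a d at
    position i is the row a e_i times d. *)
Lemma ext_adic m k c : (forall i, c i \in @adic R m C k) ->
  c \in ext (@adic R m 'rV[R]_n k).
Proof.
move=> ck; rewrite [c]Cn_delta; apply: (@rpred_sum _ (ext _)) => i _.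
have Hl : linear_pred (fun d => rowmul (delta_mx 0 i) d \in ext (@adic R m 'rV[R]_n k)).
  split=> [|a d d' dP d'P].
    suff -> : rowmul (delta_mx 0 i) 0 = 0 by rewrite rpred0.
    by apply: dprodP => j; apply: scaler0.
  suff -> : rowmul (delta_mx 0 i) (a *: d + d') =
      a *: rowmul (delta_mx 0 i) d + rowmul (delta_mx 0 i) d'.
    by rewrite rpredD ?rpredZ.
  apply: dprodP => j.
  by rewrite [LHS]scalerDr scalerA mulrC -scalerA.
apply: (lspan_ind Hl _ (ck i)) => _ [a ak [d _ ->]].
have -> : rowmul (delta_mx 0 i) (a *: d) = rowmul (a *: delta_mx 0 i) d.
  apply: dprodP => j.
  by rewrite /rowmul !mxE scalerA mulrC.
exact/mem_ext/mem_adic.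
Qed.

Section TensorSum.
Variables (X : lmodType R) (e : 'I_n -> X).

Lemma ext_span U (W : submodClosed (tensor X C)) c : c \in ext U ->
  (forall r d, r \in U -> tens (lincomb e r) d \in W) ->
  \sum_i tens (e i) (c i) \in W.
Proof.
move=> cU UW.
have Hl : linear_pred (fun c : Cn => \sum_i tens (e i) (c i) \in W).
  split=> [|a x y xW yW].
    by rewrite big1 ?rpred0 // => i _; apply: tens0r.
  have -> : \sum_i tens (e i) ((a *: x + y) i) =
      a *: (\sum_i tens (e i) (x i)) + \sum_i tens (e i) (y i).
    rewrite scaler_sumr -big_split; apply: eq_bigr => i _.
    by rewrite -[LHS]/(tensr (e i) (a *: x i + y i)) linearP.
  by rewrite rpredD ?rpredZ.
apply: (lspan_ind Hl _ cU) => _ [r rU [d ->]].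
by rewrite -tens_lincomb; apply: UW.
Qed.

Lemma ext_tens U c : c \in ext U -> {in U, forall r, lincomb e r = 0} ->
  \sum_i tens (e i) (c i) = 0.
Proof.
move=> cU U0; pose W : submodClosed (tensor X C) := lspan (fun=> False).
have : \sum_i tens (e i) (c i) \in W.
  by apply: (ext_span cU) => r d /U0 ->; rewrite tens0l rpred0.
move=> /lspanP[[|p s] [sP ->]]; first by rewrite big_nil.
by case: (sP p (mem_head _ _)).
Qed.

(** If the e_i generate X, a vanishing sum of tensors e_i (x) c_i is explained by
    relations between the e_i.  Choosing coordinates rho gives a map
    (x, d) |-> rho(x) d from X x C to C^n / KC, where K is the module of relations;
    it is bilinear because the defects of linearity of rho are in K, and it sends
    the sum to the class of c. *)
Lemma tensor_eq0 c : (forall x, exists r, x = lincomb e r) ->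
  \sum_i tens (e i) (c i) = 0 -> c \in ext (kersub (lincomb e)).
Proof.
move=> /choice[rho rhoE] c0; set K := kersub _.
pose E : submodClosed Cn := ext K.
pose h x d := lpi E (rowmul (rho x) d).
have KP r : reflect (lincomb e r = 0) (r \in K) by apply: kersubP.
have bil : bilinear_map h.
  split=> [d a x x'|x a d d']; rewrite /h -linearP; last first.
    congr (lpi _ _); apply: dprodP => i.
    by rewrite [LHS]scalerDr scalerA mulrC -scalerA.
  apply/lpi_eqP.
  rewrite -rowmulP -rowmulB.
  by apply/mem_ext/KP; rewrite linearB linearP /= -!rhoE subrr.
pose g : {linear tensor X C -> lquot E} := HB.pack_for {linear tensor X C -> lquot E}
  (tensor_lift h) (GRing.isLinear.Build R _ _ _ (tensor_lift h) (tensor_lift_linear bil)).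
have : \sum_i h (e i) (c i) = 0.
  rewrite -[RHS](linear0 g) -[in RHS]c0 linear_sum; apply: eq_bigr => i _.
  by rewrite [RHS](tensor_liftE bil).
move=> h0; rewrite -[c]subr0; apply/(lpi_eqP E); rewrite linear0 -h0.
rewrite [c in LHS]Cn_delta linear_sum; apply: eq_bigr => i _.
apply/lpi_eqP.
rewrite -rowmulB.
by apply/mem_ext/KP; rewrite linearB /= lincomb_delta -rhoE subrr.
Qed.

End TensorSum.

Lemma lincomb_lpi U r : lincomb (fun i => lpi U (delta_mx 0 i)) r = lpi U r.
Proof.
rewrite [in RHS](row_sum_delta r) linear_sum; apply: eq_bigr => i _.
by rewrite linearZ.
Qed.

Lemma lquot_gen U (q : lquot U) :
  exists r, q = lincomb (fun i => lpi U (delta_mx 0 i)) r.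
Proof. by exists (lrep q); rewrite lincomb_lpi lrepK. Qed.

Lemma ext_quot U c : \sum_i tens (lpi U (delta_mx 0 i)) (c i) = 0 -> c \in ext U.
Proof.
move=> /(tensor_eq0 (@lquot_gen U)); apply: ext_mono => r.
by move=> /kersubP /=; rewrite lincomb_lpi => /lpi_eq0.
Qed.

Hypothesis C_flat : flat C.

(** The equational criterion of flatness: the submodule generated by the g_i,
    presented as R^n / ker, stays embedded in G after tensoring with C, so
    that [tensor_eq0] applies to it. *)
Lemma flat_eq0 (G : lmodType R) (g : 'I_n -> G) c :
  \sum_i tens (g i) (c i) = 0 -> c \in ext (kersub (lincomb g)).
Proof.
move=> c0; apply: ext_quot.
apply: (C_flat (@factor_inj _ _ _ (lincomb g))).
rewrite linear0 -[RHS]c0; apply: etrans (tensor_map_sum _ _ _ _) _.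
apply: eq_bigr => i _; congr tens; rewrite -[RHS](lincomb_delta g i).
exact: (factorE (lincomb g) (delta_mx 0 i)).
Qed.

(** Apply the criterion to the family (v_i, w_i) of V x W. *)
Lemma flat_eq0_meet (V W : lmodType R) (v : 'I_n -> V) (w : 'I_n -> W) c :
  \sum_i tens (v i) (c i) = 0 -> \sum_i tens (w i) (c i) = 0 ->
  c \in ext (meetsub (kersub (lincomb v)) (kersub (lincomb w))).
Proof.
move=> v0 w0; pose G : lmodType R := (V * W)%type.
pose f1 : {linear V -> G} := inj1 W; pose f2 : {linear W -> G} := inj2 V.
pose g i : G := f1 (v i) + f2 (w i).
have gE r : lincomb g r = f1 (lincomb v r) + f2 (lincomb w r).
  rewrite -!lincomb_map -big_split; apply: eq_bigr => i _ /=.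
  exact: scalerDr.
have c0 : \sum_i tens (g i) (c i) = 0.
  transitivity (\sum_i tens (f1 (v i)) (c i) + \sum_i tens (f2 (w i)) (c i)).
    by rewrite -big_split; apply: eq_bigr => i _; rewrite tensDl.
  have v1 := tensor_map_eq0 f1 idfun v0; have w1 := tensor_map_eq0 f2 idfun w0.
  exact: etrans (congr2 +%R v1 w1) (addr0 0).
apply: ext_mono (flat_eq0 c0) => r /kersubP; rewrite [LHS]gE => gr0.
apply/meetsubP; split; apply/kersubP.
  by have := congr1 fst gr0; rewrite /= addr0.
by have := congr1 snd gr0; rewrite /= add0r.
Qed.

(** UC and WC meet in (U meet W)C: the kernel of R^n -> R^n/U x R^n/W is the
    intersection. *)
Lemma ext_meet U W c : c \in ext U -> c \in ext W -> c \in ext (meetsub U W).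
Proof.
have kerE (T : submodClosed 'rV[R]_n) r :
    lincomb (fun i => lpi T (delta_mx 0 i)) r = 0 <-> r \in T.
  by rewrite lincomb_lpi; split=> /lpi_eq0.
have T0 (T : submodClosed 'rV[R]_n) : c \in ext T ->
    \sum_i tens (lpi T (delta_mx 0 i)) (c i) = 0.
  by move=> cT; apply: (ext_tens cT) => r /kerE.
move=> /T0 cU /T0 cW; apply: ext_mono (flat_eq0_meet cU cW) => r.
move=> /meetsubP[/kersubP /kerE rU].
by move=> /kersubP /kerE rW; apply/meetsubP.
Qed.

End Ext.


(** * Reduction to finitely generated modules *)

Lemma rV_fg (R : comNzRingType) n : finitely_generated ('rV[R]_n : lmodType R).
Proof.
exists [seq delta_mx 0 i | i <- enum 'I_n] => x; rewrite [x]row_sum_delta.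
apply: rpred_sum => i _; apply/rpredZ/mem_lspan/map_f; exact: mem_enum.
Qed.

Lemma tensor_fg (R : comNzRingType) (A B : lmodType R) :
  finitely_generated A -> finitely_generated B -> finitely_generated (tensor A B).
Proof.
move=> [s As] [t Bt]; pose u := [seq tens a b | a <- s, b <- t].
exists u => x; have : x \in lspan (fun z => exists a (b : B), z = tens a b).
  exact: tensor_gen.
pose W : submodClosed (tensor A B) := span u.
suff sub : {subset lspan (fun z => exists a (b : B), z = tens a b) <= W} by move/sub.
apply: lspan_min => _ [a [b ->]].
have HB a' : a' \in s -> linear_pred (fun b => tens a' b \in W).
  split=> [|c y z yW zW]; first by rewrite tens0r rpred0.
  by rewrite tensPr rpredD ?rpredZ.
have HA : linear_pred (fun a => tens a b \in W).
  split=> [|c y z yW zW]; first by rewrite tens0l rpred0.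
  by rewrite tensPl rpredD ?rpredZ.
apply: (lspan_ind HA _ (As a)) => a' a's.
apply: (lspan_ind (HB a' a's) _ (Bt b)) => b' b't.
apply: mem_lspan; apply/allpairsP; by exists (a', b').
Qed.

(** A vanishing sum of tensors in A (x) B vanishes because of finitely many
    bilinear relations, which involve finitely many elements of A.  So the sum
    already vanishes over a finitely generated submodule of A. *)
Section FinitelyGeneratedLift.
Variables (R : comNzRingType) (A B : lmodType R).

Section Lift.
Variable T : seq A.

(** The submodule spanned by T, as a quotient of a free module. *)
Definition fgmod : lmodType R := lquot (kersub (lincomb (fun i : 'I_(size T) => T`_i))).
Definition fginc : {linear fgmod -> A} :=
  @factor R _ _ (lincomb (fun i : 'I_(size T) => T`_i)).

Lemma fginc_lift_ex a : exists q : fgmod, a \in span T -> fginc q = a.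
Proof.
have [/span_lincomb[r ->]|] := boolP (a \in span T); last by exists 0.
by exists (lpi _ r) => _; apply: factorE.
Qed.
Definition fglift a : fgmod := sval (cid (fginc_lift_ex a)).

Lemma fgliftK a : a \in span T -> fginc (fglift a) = a.
Proof. exact: svalP (cid (fginc_lift_ex a)). Qed.

Lemma fgliftP c a a' : a \in span T -> a' \in span T ->
  fglift (c *: a + a') = c *: fglift a + fglift a'.
Proof.
move=> aT a'T; apply: factor_inj; rewrite -/fginc.
have -> : @factor R _ _ (lincomb (fun i : 'I_(size T) => T`_i)) (fglift (c *: a + a'))
    = c *: a + a' by apply: fgliftK; rewrite rpredD ?rpredZ.
rewrite -{1}(fgliftK aT) -{1}(fgliftK a'T) -linearP //.
Qed.

Definition fgtens a (b : B) : tensor fgmod B := tens (fglift a) b.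
End Lift.

(** [fglift T] is linear on the span of T only, so that a relation is respected
    once T contains the elements of A that it involves. *)
Lemma fgtens_rel z : bilinear_rel z ->
  exists T0 : seq A, forall T, {subset T0 <= T} -> free_lift (fgtens T) z = 0.
Proof.
have fr T a b : free_lift (fgtens T) << (a, b) >> = fgtens T a b.
  exact: free_liftU.
case=> [a a' b|a b b'|c a b|c a b].
- exists [:: a; a'] => T sT; rewrite linearB linearD /= !fr /fgtens.
  have aT : a \in span T by apply/mem_lspan/sT; rewrite inE eqxx.
  have a'T : a' \in span T by apply/mem_lspan/sT; rewrite !inE eqxx orbT.
  by rewrite -[a + a']/(a + a') -{1}[a]scale1r fgliftP // scale1r tensDl subrr.
- exists [::] => T _; rewrite linearB linearD /= !fr /fgtens.
  by rewrite -[tens _ (b + b')]/(tensr _ (b + b')) linearD subrr.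
- exists [:: a] => T sT; rewrite linearB linearZ /= !fr /fgtens.
  have aT : a \in span T by apply/mem_lspan/sT; rewrite inE eqxx.
  have f0 : fglift T 0 = 0.
    have := fgliftP (-1) (rpred0 (span T)) (rpred0 (span T)).
    by rewrite scaler0 addr0 scaleN1r addNr.
  by have := fgliftP c aT (rpred0 (span T)); rewrite f0 !addr0 => ->; rewrite tensZl subrr.
- exists [::] => T _; rewrite linearB linearZ /= !fr /fgtens.
  by rewrite tensZr subrr.
Qed.

(** Tensor products commute with direct limits. *)
Lemma tensor_eq0_fg n (x : 'I_n -> A) (y : 'I_n -> B) :
  \sum_i tens (x i) (y i) = 0 ->
  exists (A' : lmodType R) (f : {linear A' -> A}) (x' : 'I_n -> A'),
    [/\ finitely_generated A', forall i, f (x' i) = x i & \sum_i tens (x' i) (y i) = 0].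
Proof.
move=> xy0; pose F := {malg R[(A * B)%type]}.
pose g : F := \sum_i << (x i, y i) >>.
have : g \in lspan (@bilinear_rel R A B).
  by rewrite -[g]subr0; apply/lpi_eqP; rewrite linear0 linear_sum -[RHS]xy0.
move=> /lspanP[s [sP gE]].
have [T0 T0P] : exists T0 : seq A, forall T, {subset T0 <= T} -> forall p, p \in s ->
    free_lift (fgtens T) p.2 = 0.
  elim: s sP {gE} => [|p s IHs] sP; first by exists [::].
  have [q qs|T1 T1P] := IHs; first by apply: sP; rewrite inE qs orbT.
  have [T2 T2P] := fgtens_rel (sP p (mem_head _ _)).
  exists (T1 ++ T2) => T sT q; rewrite inE => /predU1P[->|qs].
    by apply: T2P => a aT; apply: sT; rewrite mem_cat aT orbT.
  by apply: T1P => // a aT; apply: sT; rewrite mem_cat aT.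
pose T := T0 ++ codom x.
exists (fgmod T), (fginc T), (fun i => fglift T (x i)); split.
- exact/lquot_fg/rV_fg.
- by move=> i; apply/fgliftK/mem_lspan; rewrite mem_cat codom_f orbT.
have : free_lift (fgtens T) g = 0.
  rewrite gE linear_sum big_seq big1 // => p ps; rewrite linearZ /= T0P ?scaler0 //.
  by move=> a aT; rewrite mem_cat aT.
move=> g0; rewrite -[RHS]g0 linear_sum; apply: eq_bigr => i _.
by rewrite /= free_liftU.
Qed.

End FinitelyGeneratedLift.

(** * Ideals and quotients *)

Section Quotients.
Variables (R : comNzRingType) (m : {pred R}).
Local Notation adicm V n := (@adic R m V n).

Lemma smul_lift (V : lmodType R) (U : submodClosed V) (I : {pred R}) q :
  q \in @smul R (lquot U) I predT ->
  exists2 v, v \in smul I (predT : {pred V}) & q = lpi U v.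
Proof.
have Hl : linear_pred (fun q => exists2 v, v \in smul I (predT : {pred V}) & q = lpi U v).
  split=> [|a _ _ [v vI ->] [w wI ->]]; first by exists 0; rewrite ?rpred0 ?linear0.
  by exists (a *: v + w); rewrite ?linearP // rpredD ?rpredZ.
apply: (lspan_ind Hl) => _ [a aI [x _ ->]].
exists (a *: lrep x); last by rewrite linearZ /= lrepK.
by apply: mem_lspan; exists a => //; exists (lrep x).
Qed.

Lemma smul_linear (V W : lmodType R) (f : {linear V -> W}) (I : {pred R}) v :
  v \in smul I (predT : {pred V}) -> f v \in smul I (predT : {pred W}).
Proof.
have Hl : linear_pred (fun v => f v \in smul I (predT : {pred W})).
  split=> [|a x y fx fy]; first by rewrite linear0 rpred0.
  by rewrite linearP rpredD // rpredZ.
apply: (lspan_ind Hl) => _ [a an [x _ ->]].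
by rewrite linearZ; apply: mem_lspan; exists a => //; exists (f x).
Qed.

Lemma adic_quot0 (V : lmodType R) n (q : lquot (adicm V n)) :
  q \in adicm (lquot (adicm V n)) n -> q = 0.
Proof. by move=> /smul_lift[v vn ->]; apply/lpi_eq0. Qed.

(** Lifting elements of B / m^n B gives a map A (x) B/m^n B -> (A (x) B)/m^n
    through which the projection of A (x) B factors. *)
Lemma tensor_quot_ker (A B : lmodType R) n (t : tensor A B) :
  tensor_map (idfun : {linear A -> A}) (lpi (adicm B n)) t = 0 ->
  t \in adicm (tensor A B) n.
Proof.
set E : submodClosed (tensor A B) := adicm (tensor A B) n.
pose h (a : A) (q : lquot (adicm B n)) := lpi E (tens a (lrep q)).
have hE a b : h a (lpi _ b) = lpi E (tens a b).
  apply/lpi_eqP; rewrite -[tens a b]/(tensr a b) -[tens _ _]/(tensr a _) -linearB.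
  exact/adic_linear/lpi_rep.
have bil : bilinear_map h.
  split=> [q c a a'|a c q q'].
    by rewrite /h tensPl linearP.
  rewrite -[q]lrepK -[q']lrepK -linearP !hE -linearP.
  by rewrite tensPr.
pose g : {linear tensor A (lquot (adicm B n)) -> lquot E} :=
  HB.pack_for {linear tensor A (lquot (adicm B n)) -> lquot E}
  (tensor_lift h) (GRing.isLinear.Build R _ _ _ (tensor_lift h) (tensor_lift_linear bil)).
have [k [x [y ->]]] := tensor_sum t; move=> t0; apply/lpi_eq0.
have : g (tensor_map idfun (lpi (adicm B n)) (\sum_i tens (x i) (y i))) = 0.
  by rewrite t0 linear0.
rewrite tensor_map_sum linear_sum => <-; rewrite linear_sum.
by apply: eq_bigr => i _; rewrite /= (tensor_liftE bil) hE.
Qed.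

Lemma sum_swap (A B : lmodType R) n (x : 'I_n -> A) (y : 'I_n -> B) :
  \sum_i tens (x i) (y i) = 0 -> \sum_i tens (y i) (x i) = 0.
Proof.
move=> xy0; transitivity (@tswap R A B (\sum_i tens (x i) (y i))).
  by rewrite linear_sum; apply: eq_bigr => i _; rewrite /= tswapE.
by rewrite xy0 linear0.
Qed.

(** A submodule of R^1 is an ideal, and UC is then a product of an ideal with C. *)
Lemma ext1 (C : lmodType R) (U : submodClosed 'rV[R]_1) (I : {pred R}) (c : C) :
  (forall r : 'rV[R]_1, r \in U -> r 0 0 \in I) ->
  ((fun=> c) : dprod (fun _ : 'I_1 => C)) \in ext U -> c \in smul I (predT : {pred C}).
Proof.
move=> UI.
have Hl : linear_pred (fun z : dprod (fun _ : 'I_1 => C) =>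
    z 0 \in smul I (predT : {pred C})).
  split=> [|a x y xI yI]; first exact: rpred0.
  by apply: rpredD => //; apply: rpredZ.
apply: (lspan_ind Hl) => _ [r /UI rI [d ->]].
by apply: mem_lspan; exists (r 0 0) => //; exists d.
Qed.

End Quotients.

(** * Completions *)

Section Completion.
Variables (R : comNzRingType) (m : {pred R}) (M : lmodType R).
Local Notation adicm V n := (@adic R m V n).
Local Notation C := (completion m M).

Definition cproj n (c : C) : lquot (adicm M n) := completion_val c n.
Fact cproj_linear n : linear (cproj n).
Proof. by []. Qed.
HB.instance Definition _ n := GRing.isLinear.Build R C _ _ (cproj n) (cproj_linear n).

Lemma cproj_inj (c d : C) : (forall n, cproj n c = cproj n d) -> c = d.
Proof. by move=> cd; apply: val_inj; apply: functional_extensionality_dep. Qed.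

Lemma cproj_adic n (c : C) : c \in adicm C n -> cproj n c = 0.
Proof. by move=> /(adic_linear (cproj n)) /adic_quot0. Qed.

(** The kernel of C -> M / m^n M contains m^n C, so the n-th components of the
    d k are constant from k = n on; they form the limit. *)
Lemma completion_limit (d : nat -> C) : (forall n, d n.+1 - d n \in adicm C n) ->
  exists l, forall n, cproj n l = cproj n (d n).
Proof.
move=> dP.
have dE n k : (n <= k)%N -> cproj n (d k) = cproj n (d n).
  move=> /subnK <-; elim: (k - n)%N => // i IHi; rewrite addSn -IHi.
  apply/eqP; rewrite -subr_eq0 -linearB; apply/eqP/cproj_adic.
  exact: adic_sub (leq_addl i n) _ (dP _).
have lP : ((fun n => cproj n (d n)) : dprod _) \in @adic_compatible R m M.
  apply/asboolP => n k nk; rewrite -[RHS](dE n k nk).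
  by case: (d k) => v /= /asboolP /(_ n k nk).
by exists (Completion lP).
Qed.

End Completion.

Lemma complete_ring_limit (R : comNzRingType) (m : {pred R}) : complete_ring m ->
  forall r : nat -> R, (forall n, r n.+1 - r n \in idpow m n) ->
  exists l, forall n, l - r n \in idpow m n.
Proof.
case=> g _ gK r rP.
have [n|l lP] := @completion_limit R m R^o (fun n => completion_map m R^o (r n)).
  by rewrite -linearB; apply: adic_linear; rewrite adic_ring.
exists (g l) => n; rewrite -adic_ring; apply/lpi_eqP.
by have := lP n; rewrite -[l in LHS]gK.
Qed.

Lemma finitely_generated_lincomb (R : comNzRingType) (V : lmodType R) :
  finitely_generated V ->
  exists b (e : 'I_b -> V), forall v, exists r, v = lincomb e r.
Proof.
move=> [s Vs]; exists (size s), (fun i => s`_i) => v; exact: span_lincomb.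
Qed.

Section FlatCompletion.
Variables (R : comNzRingType) (m : {pred R}) (M : lmodType R).
Local Notation adicm V n := (@adic R m V n).
Local Notation C := (completion m M).
Hypotheses (R_noeth : noetherian R) (C_flat : flat C).

(** For L generated by l_1, ..., l_a, the submodule LC of C^b is the image of
    [lsum]; it is shown to be closed. *)
Section Relations.
Variables (b a : nat) (l : 'I_a -> 'rV[R]_b) (L : submodClosed 'rV[R]_b).
Hypothesis l_L : forall j, l j \in L.
Hypothesis L_l : forall u, u \in L -> exists r, u = lincomb l r.
Local Notation Cb := (dprod (fun _ : 'I_b => C)).

Definition lsum (d : 'I_a -> C) : Cb := \sum_j rowmul (l j) (d j).

Lemma lsumE d i : lsum d i = \sum_j l j 0 i *: d j.
Proof. exact: dprod_sumE. Qed.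

(** Elements of m^n LC have coefficients in m^n C. *)
Lemma ext_lsum n (u : Cb) : u \in ext (smul (idpow m n) L) ->
  exists2 d, (forall j, d j \in adicm C n) & u = lsum d.
Proof.
have Hl : linear_pred (fun u : Cb =>
    exists2 d, (forall j, d j \in adicm C n) & u = lsum d).
  split=> [|c _ _ [d dP ->] [d' dP' ->]].
    exists (fun=> 0); first by move=> j; apply: rpred0.
    by apply: dprodP => i; rewrite lsumE big1 // => j _; rewrite scaler0.
  exists (fun j => c *: d j + d' j); first by move=> j; rewrite rpredD ?rpredZ.
  apply: dprodP => i.
  rewrite -[LHS]/(c *: lsum d i + lsum d' i) !lsumE scaler_sumr -big_split.
  by apply: eq_bigr => j _; rewrite /= scalerDr !scalerA mulrC.
apply: (lspan_ind Hl) => _ [r rL [c ->]].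
have [s sn ->] := smul_coord (idpow_submod m n) L_l rL.
exists (fun j => s 0 j *: c); first by move=> j; apply: mem_adic.
apply: dprodP => i.
rewrite lsumE /rowmul /lincomb summxE scaler_suml.
by apply: eq_bigr => j _; rewrite mxE mulrC scalerA.
Qed.

Lemma lsum_ext d : lsum d \in ext L.
Proof. by apply: (@rpred_sum _ (ext L)) => j _; apply: mem_ext. Qed.

Lemma lsumB d d' i : lsum d i - lsum d' i = lsum (fun j => d j - d' j) i.
Proof.
by rewrite !lsumE -sumrB; apply: eq_bigr => j _; rewrite scalerBr.
Qed.

(** By flatness LC meets m^k C^b in (L meet m^k R^b)C, which Artin-Rees puts
    inside m^n LC. *)
Lemma lsum_refine n : exists2 k, (n <= k)%N & forall d : 'I_a -> C,
  (forall i, lsum d i \in adicm C k) ->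
  exists2 d', (forall j, d' j \in adicm C n) & lsum d' = lsum d.
Proof.
have [k kP] := artin_rees m R_noeth (rV_fg R b) L n.
exists (maxn n k); first exact: leq_maxl.
move=> d dk.
have dE : lsum d \in ext (adicm 'rV[R]_b k).
  by apply: ext_adic => i; apply: adic_sub (leq_maxr n k) _ (dk i).
have /ext_mono sub : {subset meetsub (adicm 'rV[R]_b k) L <= smul (idpow m n) L}.
  by move=> r /meetsubP[rk rL]; apply: kP.
by have [d' d'n ->] := ext_lsum (sub _ _ (ext_meet C_flat dE (lsum_ext d))); exists d'.
Qed.

(** An approximation [lsum d] of c of order k(n) is corrected by coefficients in
    m^n C to one of order k(n+1), so the coefficients converge. *)
Lemma lsum_closed (c : Cb) :
  (forall k, exists d, forall i, c i - lsum d i \in adicm C k) ->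
  exists d, c = lsum d.
Proof.
move=> cP.
have /choice[k kP] : forall n, exists k, (n <= k)%N /\ forall d : 'I_a -> C,
    (forall i, lsum d i \in adicm C k) ->
    exists2 d', (forall j, d' j \in adicm C n) & lsum d' = lsum d.
  by move=> n; have [k nk kP] := lsum_refine n; exists k.
pose near n (d : 'I_a -> C) := forall i, c i - lsum d i \in adicm C (k n).
have step n d : exists d', near n d ->
    near n.+1 d' /\ forall j, d' j - d j \in adicm C n.
  have [dn|] := pselect (near n d); last by exists d.
  have [e eP] := cP (maxn (k n) (k n.+1)).
  have [|f fn fE] := (kP n).2 (fun j => e j - d j).
    move=> i; rewrite -lsumB.
    have -> : lsum e i - lsum d i = (c i - lsum d i) - (c i - lsum e i).
      by rewrite opprB [RHS]addrC addrA subrK.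
    by apply: rpredBs; [exact: dn | exact: adic_sub (leq_maxl _ _) _ (eP i)].
  exists (fun j => d j + f j) => _; split=> [i|j]; last by rewrite addrC addKr.
  have -> : lsum (fun j => d j + f j) i = lsum e i.
    have -> : lsum (fun j => d j + f j) i = lsum d i + lsum f i.
      by rewrite !lsumE -big_split; apply: eq_bigr => j _; rewrite scalerDr.
    by rewrite fE -lsumB addrC subrK.
  exact: adic_sub (leq_maxr _ _) _ (eP i).
have /choice[g gP] : forall n, exists g, forall d, near n d ->
    near n.+1 (g d) /\ forall j, g d j - d j \in adicm C n.
  by move=> n; have [g gP] := choice (step n); exists g.
have [d0 d0P] := cP (k 0%N).
pose s := fix s n := if n is n'.+1 then g n' (s n') else d0.
have sn n : near n (s n) by elim: n => [//|n IHn]; apply: (gP _ _ IHn).1.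
have /choice[d dP] : forall j, exists l, forall n, cproj n l = cproj n (s n j).
  by move=> j; apply: completion_limit => n; apply: (gP _ _ (sn n)).2.
exists d; apply: dprodP => i; apply: cproj_inj => n.
have -> : cproj n (lsum d i) = cproj n (lsum (s n) i).
  rewrite !lsumE !linear_sum; apply: eq_bigr => j _.
  by rewrite !linearZ /= dP.
apply/eqP; rewrite -subr_eq0 -linearB; apply/eqP/cproj_adic.
exact: adic_sub (kP n).1 _ (sn n i).
Qed.

End Relations.

Theorem flat_completion_totally_separated : totally_separated m C.
Proof.
move=> X /finitely_generated_lincomb[b [e Xe]] t tP.
pose L := kersub (lincomb e).
have [s0 F0] := rV_fg R b.
have [l lL Ll] := noetherian_span R_noeth (fun x (_ : x \in L) => F0 x).
have {}Ll u : u \in L -> exists r, u = lincomb (fun j : 'I_(size l) => l`_j) r.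
  by move=> /Ll /span_lincomb.
have {}lL (j : 'I_(size l)) : l`_j \in L by apply/lL/mem_nth.
have [c tE] := tensor_coord Xe t.
have extL u : u \in @ext R C b L -> exists d, u = lsum (fun j : 'I_(size l) => l`_j) d.
  move=> uL; suff uL0 : u \in @ext R C b (smul (idpow m 0) L).
    by have [d _ ->] := ext_lsum Ll uL0; exists d.
  apply: ext_mono uL => r rL; apply: mem_lspan.
  by exists 1 => //; exists r; rewrite ?scale1r.
have [|d cE] := @lsum_closed _ _ _ L lL Ll c.
  move=> k; have tk : t \in adicm (tensor X C) k.
    by apply: adic_sub (leqnSn k) _ (tP _ _).
  have [w wk tw] := tensor_coord_adic Xe tk.
  have [d dE] := extL _ (tensor_eq0 Xe (tens_sumB (esym tE) (esym tw))).
  exists d => i; rewrite -[lsum _ d]dE opprB addrC subrK; exact: wk.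
rewrite tE cE; apply: (ext_tens (lsum_ext lL d)) => r /kersubP; exact.
Qed.

End FlatCompletion.


(** * The Mittag-Leffler property *)

Section MittagLeffler.
Variable R : comNzRingType.

Lemma mittag_lefflerI (N : lmodType R) :
  (forall (I : Type) (Q : I -> lmodType R) n (x : 'I_n -> N) (q : 'I_n -> dprod Q),
    (forall i, \sum_j tens (x j) (q j i) = 0) -> \sum_j tens (x j) (q j) = 0) ->
  mittag_leffler N.
Proof.
move=> NP I Q t t' tt'; apply/eqP; rewrite -subr_eq0; apply/eqP.
have [n [x [q tE]]] := tensor_sum (t - t'); rewrite tE; apply: NP => i.
have <- := tensor_map_sum (idfun : {linear N -> N}) (dproj i) x q.
rewrite -tE linearB; apply/eqP; rewrite subr_eq0; apply/eqP.
exact: (congr1 (fun f => f i) tt').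
Qed.

Lemma mittag_leffler_eq0 (N : lmodType R) (I : Type) (Q : I -> lmodType R) n
    (x : 'I_n -> N) (q : 'I_n -> dprod Q) : mittag_leffler N ->
  (forall i, \sum_j tens (x j) (q j i) = 0) -> \sum_j tens (x j) (q j) = 0.
Proof.
move=> NML xq0; apply: (NML I Q); apply: functional_extensionality_dep => i.
rewrite /tensor_dprod linear0.
exact: etrans (tensor_map_sum idfun (dproj i) x q) (xq0 i).
Qed.

Lemma mittag_leffler_pure (N N' : lmodType R) (f : {linear N -> N'}) :
  pure f -> mittag_leffler N' -> mittag_leffler N.
Proof.
move=> f_pure N'ML; apply: mittag_lefflerI => I Q n x q xq0.
apply: sum_swap; apply: (f_pure (dprod Q)); rewrite linear0.
apply: etrans (tensor_map_sum idfun f q x) _.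
apply: (sum_swap (mittag_leffler_eq0 N'ML _)) => i.
exact: (tensor_map_eq0 f idfun (xq0 i)).
Qed.

Variable m : {pred R}.
Hypotheses (R_noeth : noetherian R) (R_local : local_ring m).
Local Notation adicm V n := (@adic R m V n).

(** For X finitely generated, an element of all m^k (X (x) N) dies in
    N (x) prod_k X/m^k X.  There N can be replaced by a finitely generated N',
    and the lifted element of N' (x) X is killed by Krull. *)
Lemma mittag_leffler_totally_separated (N : lmodType R) :
  mittag_leffler N -> totally_separated m N.
Proof.
move=> NML X Xfg t tP; have [n [x [y tE]]] := tensor_sum t.
rewrite tE; apply: sum_swap.
pose q j : dprod (fun k => lquot (adicm X k)) := fun k => lpi _ (x j).
have {}tP k : t \in adicm (tensor X N) k by apply: adic_sub (leqnSn k) _ (tP _ _).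
have yq0 : \sum_j tens (y j) (q j) = 0.
  apply: mittag_leffler_eq0 => // k; apply: sum_swap.
  have : tensor_map (lpi (adicm X k)) (idfun : {linear N -> N}) t = 0.
    pose f : {linear tensor X N -> _} := tensor_map (lpi (adicm X k)) idfun.
    suff sub : {subset adicm (tensor X N) k <= kersub f} by exact/kersubP/sub.
    apply: lspan_min => _ [a ak [u _ ->]]; apply/kersubP.
    have [l [z [w ->]]] := tensor_sum u; rewrite scaler_sumr linear_sum big1 // => i _.
    rewrite -tensZl; apply: etrans (tensor_mapE _ _ _ _) _.
    by apply/tens_eq0l/lpi_eq0/mem_adic.
  by rewrite tE tensor_map_sum.
have [N' [f [y' [N'fg fy' y'q0]]]] := tensor_eq0_fg yq0.
have y'x : \sum_j tens (y' j) (x j) = 0.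
  apply: (krull R_noeth R_local (tensor_fg N'fg Xfg)) => k _.
  apply: tensor_quot_ker; apply: etrans (tensor_map_sum _ _ _ _) _.
  exact: (tensor_map_eq0 idfun (dproj k) y'q0).
apply: etrans (tensor_map_eq0 f idfun y'x); apply: eq_bigr => j _.
by rewrite fy'.
Qed.

Hypothesis R_complete : forall r : nat -> R,
  (forall n, r n.+1 - r n \in idpow m n) ->
  exists l, forall n, l - r n \in idpow m n.

(** For F the submodules U of R^n with y in UN, Chevalley gives y in
    (L + m^k R^n)N for every k, where L is the module of relations of q.  So the
    sum of the classes of the unit vectors times y_j is in m^k (R^n/L (x) N) for
    all k, hence vanishes, and y is in LN. *)
Lemma flat_mittag_leffler (N : lmodType R) :
  flat N -> totally_separated m N -> mittag_leffler N.
Proof.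
move=> N_flat Nts; apply: mittag_lefflerI => I Q n y q yq0; apply: sum_swap.
pose L := kersub (lincomb q).
pose Li i := kersub (lincomb (fun j => q j i)).
pose F (U : submodClosed 'rV[R]_n) := (y : dprod (fun _ : 'I_n => N)) \in ext U.
have FLi i : F (Li i) by apply: (flat_eq0 N_flat); apply: sum_swap.
have LiL w : (forall i, w \in Li i) -> w \in L.
  move=> wL; apply/kersubP; apply: functional_extensionality_dep => i.
  have /kersubP := wL i.
  exact: (etrans (esym (lincomb_map (dproj i) q w))).
have F0 : F (adicm 'rV[R]_n 0).
  by apply: ext_adic => i; rewrite -[y i]scale1r; apply: mem_adic.
have F_dir U W : F U -> F W -> exists X, [/\ F X, {subset X <= U} & {subset X <= W}].
  move=> FU FW; exists (meetsub U W); split; first exact: ext_meet.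
    by move=> r /meetsubP[].
  by move=> r /meetsubP[].
suff yL : (y : dprod (fun _ : 'I_n => N)) \in ext L.
  by apply: (ext_tens yL) => r /kersubP.
apply: ext_quot; apply: (Nts _ (lquot_fg L (rV_fg R n))) => k _.
have [U FU UP] := chevalley R_noeth R_local (rV_fg R n) F0 F_dir R_complete k.
apply: (ext_span FU) => r d /UP[w wF rw].
rewrite lincomb_lpi.
have -> : lpi L r = lpi L (r - w).
  by apply/lpi_eqP; rewrite opprB addrC subrK; apply: LiL => i; apply: wF.
have rwX : lpi L (r - w) \in adicm (lquot L) k by apply: adic_linear.
exact: (adic_linear (tensl d) rwX).
Qed.

End MittagLeffler.

(** * Purity in the completion *)

Section Purity.
Variables (R : comNzRingType) (m : {pred R}) (M : lmodType R).
Hypothesis R_noeth : noetherian R.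
Local Notation adicm V n := (@adic R m V n).
Local Notation C := (completion m M).

Lemma prime_submod (p : prime_idealr R) : linear_pred (V := R^o) (fun a => a \in p).
Proof.
by split=> [|a x y xp yp]; rewrite ?rpred0 // rpredD // prime_idealrM xp orbT.
Qed.

(** Via y |-> 1 (x) y, M / pM embeds into R/p (x) M: by [tensor_eq0] the kernel
    consists of pM. *)
Lemma totally_separated_prime (p : prime_idealr R) :
  totally_separated m M -> separated m (lquot (smul p (predT : {pred M}))).
Proof.
move=> Mts; pose P : submodClosed R^o := mksub (prime_submod p).
pose e (_ : 'I_1) : lquot P := lpi P 1.
have eE r : lincomb e r = lpi P (r 0 0).
  by rewrite /lincomb big_ord1 -linearZ /= [_ *: _]mulr1.
have Pgen (x : lquot P) : exists r, x = lincomb e r.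
  by exists (const_mx (lrep x)); rewrite eE mxE lrepK.
have Pfg : finitely_generated (lquot P).
  apply: lquot_fg; exists [:: 1] => x; rewrite -[x]mulr1.
  by apply/rpredZ/mem_lspan/mem_head.
move=> x xP; rewrite -[x]lrepK; apply/lpi_eq0; set y := lrep x.
apply: (@ext1 _ _ (kersub (lincomb e))).
  by move=> r /kersubP; rewrite [LHS]eE => /lpi_eq0 /(mksubP (prime_submod p)).
pose f : {linear M -> tensor (lquot P) M} := tensr (lpi P 1).
have killp v : v \in smul p (predT : {pred M}) -> f v = 0.
  suff sub : {subset smul p (predT : {pred M}) <= kersub f} by move=> /sub /kersubP.
  apply: lspan_min => _ [a ap [u _ ->]]; apply/kersubP.
  apply: etrans (esym (tens_swap_scale a (lpi P 1) u)) _; rewrite -linearZ.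
  apply/tens_eq0l/lpi_eq0/(mksubP (prime_submod p)).
  by rewrite [_ *: _]mulr1.
apply: (tensor_eq0 (e := e) Pgen); rewrite big_ord1.
apply: (Mts _ Pfg) => n n1.
have [v vn xv] := smul_lift (xP n n1).
suff -> : tens (e 0) y = f v by apply: adic_linear.
have /killp : y - v \in smul p (predT : {pred M}).
  by apply/lpi_eqP; rewrite lrepK.
by rewrite linearB => /eqP; rewrite subr_eq0 => /eqP.
Qed.

Hypothesis C_flat : flat C.

(** Since M and C have the same quotients M / m^n M, an element of M in IC is in
    IM + m^n M for all n. *)
Lemma completion_smul (I : {pred R}) y :
  separated m (lquot (smul I (predT : {pred M}))) ->
  completion_map m M y \in smul I (predT : {pred C}) ->
  y \in smul I (predT : {pred M}).
Proof.
move=> Isep yI; apply/lpi_eq0; apply: Isep => n _.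
have /smul_lift[u uI yu] := smul_linear (cproj n) yI.
have yun : y - u \in adicm M n by apply/lpi_eqP.
have -> : lpi (smul I (predT : {pred M})) y = lpi (smul I (predT : {pred M})) (y - u).
  by apply/lpi_eqP; rewrite opprB addrC subrK.
exact: adic_linear.
Qed.

(** Take U maximal inside the span of the x_i such that the image of U (x) M in
    X (x) M meets the kernel of X (x) M -> X (x) C trivially.  If some x_i is not
    in U, a multiple z of it has a prime annihilator p modulo U.  An element
    z (x) w + u of the kernel, with u coming from U, gives z (x) w = 0 in
    X/U (x) C, so w is in pC by flatness and then in pM; as pz is inside U, the
    element comes from U and is zero.  So U + Rz would be larger. *)
Lemma prime_separated_pure :
  (forall p : prime_idealr R, separated m (lquot (smul p (predT : {pred M})))) ->
  pure (completion_map m M).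
Proof.
move=> psep X.
pose f : {linear tensor X M -> tensor X C} := tensor_map idfun (completion_map m M).
suff f0 t : f t = 0 -> t = 0.
  move=> t t' tt'; apply/eqP; rewrite -subr_eq0; apply/eqP/f0.
  by rewrite linearB /= [X in X - _]tt' subrr.
have [n [x [y ->]]] := tensor_sum t.
pose XM (U : submodClosed X) : submodClosed (tensor X M) :=
  lspan (fun s => exists2 u, u \in U & exists y, s = tens u y).
pose V0 : submodClosed X := span (codom x).
have [|U [Us Ugood] Umax] := noetherian_max R_noeth (s := codom x)
  (P := fun U => {subset U <= V0} /\ forall t, t \in XM U -> f t = 0 -> t = 0)
  (U0 := lspan (fun=> False)) _ (fun U PU => PU.1).
  split=> [|t']; first exact: lspan_min.
  suff sub : {subset XM (lspan (fun=> False)) <= lspan (fun=> False)}.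
    move=> /sub /lspanP[[|p s] [sP ->]] _; first by rewrite big_nil.
    by case: (sP p (mem_head _ _)).
  apply: (@lspan_min _ _ _ (lspan _)) => _ [u /lspanP[s [sP ->]] [z ->]].
  case: s sP => [|p s] sP; first by rewrite big_nil tens0l rpred0.
  by case: (sP p (mem_head _ _)).
apply: (Ugood); apply: rpred_sum => i _; apply: mem_lspan.
exists (x i); last by exists (y i).
apply: contraT => /(assoc_prime R_noeth)[p [a pE]].
set z := a *: x i in pE.
rewrite -(idealr1 p) pE scale1r; apply: (Umax (adjoin U z)); last first.
- exact: mem_adjoin.
- exact: sub_adjoin.
split=> [_ /adjoinP[r [u /Us uV ->]]|t' t'W ft'].
  by rewrite rpredD // !rpredZ //; apply/mem_lspan/codom_f.
have [u uU [w t'E]] : exists2 u, u \in XM U & exists w, t' = tens z w + u.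
  have Hl : linear_pred (fun t' => exists2 u, u \in XM U & exists w, t' = tens z w + u).
    split=> [|c _ _ [u uU [w ->]] [u' u'U [w' ->]]].
      by exists 0; rewrite ?rpred0 //; exists 0; rewrite tens0r addr0.
    exists (c *: u + u'); first by rewrite rpredD ?rpredZ.
    by exists (c *: w + w'); rewrite tensPr scalerDr addrACA.
  apply: (lspan_ind Hl _ t'W) => _ [_ /adjoinP[r [u uU ->]] [w ->]].
  exists (tens u w); first by apply: mem_lspan; exists u => //; exists w.
  by exists (r *: w); rewrite tensPl tensZr.
pose g : {linear tensor X C -> tensor (lquot U) C} := tensor_map (lpi U) idfun.
have gu : g (f u) = 0.
  pose gf : {linear tensor X M -> tensor (lquot U) C} := g \o f.
  suff sub : {subset XM U <= kersub gf} by apply: (kersubP gf u _); exact: sub.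
  apply: lspan_min => _ [v vU [w0 ->]]; apply/kersubP.
  have fE : f (tens v w0) = tens v (completion_map m M w0) by apply: tensor_mapE.
  rewrite -[LHS]/(g (f (tens v w0))) fE; apply: etrans (tensor_mapE _ _ _ _) _.
  exact/tens_eq0l/lpi_eq0.
have wC : completion_map m M w \in smul p (predT : {pred C}).
  apply: (@ext1 _ _ (kersub (lincomb (fun _ : 'I_1 => lpi U z)))).
    move=> r /kersubP; rewrite [LHS]big_ord1 -linearZ => /lpi_eq0.
    by rewrite -pE.
  apply: (flat_eq0 C_flat); rewrite big_ord1.
  have <- : g (f t') = 0 by rewrite ft' linear0.
  have fE : f (tens z w) = tens z (completion_map m M w) by apply: tensor_mapE.
  rewrite t'E [f _]linearD [g _]linearD gu addr0 fE.
  exact/esym/tensor_mapE.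
apply: Ugood ft'; rewrite t'E rpredD //.
have Hl : linear_pred (fun w => tens z w \in XM U).
  split=> [|c v v' vU v'U]; first by rewrite tens0r rpred0.
  by rewrite tensPr rpredD ?rpredZ.
apply: (lspan_ind Hl _ (completion_smul (psep p) wC)) => _ [c cp [v _ ->]].
rewrite -tens_swap_scale.
by apply: mem_lspan; exists (c *: z); [rewrite -pE | exists v].
Qed.

Lemma pure_totally_separated :
  pure (completion_map m M) -> totally_separated m M.
Proof.
move=> M_pure X Xfg; apply: (separated_inj (M_pure X)).
exact: flat_completion_totally_separated.
Qed.

End Purity.

Theorem mainTheorem9 (R : comNzRingType) (m : {pred R}) (M : lmodType R)
    (R_noeth : noetherian R) (R_local : local_ring m)
    (M_sep : separated m M) (M_flat : flat (completion m M)) :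
  [<-> totally_separated m M;
       forall p : prime_idealr R, separated m (lquot (smul p (predT : {pred M})));
       pure (completion_map m M)]
  /\
  (complete_ring m ->
   [<-> totally_separated m M;
        forall p : prime_idealr R, separated m (lquot (smul p (predT : {pred M})));
        pure (completion_map m M);
        mittag_leffler M]).
Proof.
split=> [|R_complete]; tfae.
- by move=> Mts p; apply: totally_separated_prime.
- exact: prime_separated_pure.
- exact: pure_totally_separated.
- by move=> Mts p; apply: totally_separated_prime.
- exact: prime_separated_pure.
- move=> M_pure; apply: mittag_leffler_pure M_pure _.
  apply: (flat_mittag_leffler R_noeth R_local (complete_ring_limit R_complete)) => //.
  exact: flat_completion_totally_separated.
- exact: mittag_leffler_totally_separated.
Qed.
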